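(* Let $X:\Sigma\to\mathbb{S}^2\times\mathbb{R}$ be a minimal conformal immersion with Gauss map $g$, and let $p$ be the stereographic projection of its $\mathbb{S}^2$-component. The curvature $K$ of the metric induced by $X$ is $$K=\frac{(|g-p|^2-|1+\bar g p|^2)^2}{(1+|g|^2)^2(1+|p|^2)^2|g_z|^2}\,\bigl(|g_z|^2-|\bar g_z|^2\bigr).$$ This formula holds when $g\neq\infty$. In particular, $K$ vanishes at singular points of $g$.
   Context: Model: $\mathbb{S}^2\times\mathbb{R}$ (with $\mathbb{S}^2$ the unit sphere and the product metric) is identified with $\mathbb{R}^3\setminus\{0\}$ with the metric $d\mu^2=|x|^{-2}(dx_1^2+dx_2^2+dx_3^2)$ through the isometry $(y,t)\mapsto e^t y$. $\Sigma$ is an oriented Riemannian surface, with local conformal coordinate $z=u+iv$; minimal means zero mean curvature with respect to $d\mu^2$. Notation: $\bar g_z=(\bar g)_z$. Gauss map: $E_j(x)=|x|\partial_{x_j}$, $j=1,2,3$, is a global orthonormal frame. Let $N=N_1E_1+N_2E_2+N_3E_3$ be the unit normal of $X$ in the direction of $X_u\times X_v$. The Gauss map of $X$ is $$g=\frac{N_1+iN_2}{1+N_3}:\Sigma\to\bar{\mathbb{C}}=\mathbb{C}\cup\{\infty\}.$$ A singular point of $g$ is a point where the differential of $g$ is non-invertible (i.e. $|g_z|^2-|\bar g_z|^2=0$ if $g\ne\infty$ there). Map $p$: writing $X=(F,h)$ with $F=x_1+ix_2$, $h=x_3$ along $X$ and $|X|=\sqrt{|F|^2+h^2}$, let $p=\dfrac{F}{|X|+h}:\Sigma\to\bar{\mathbb{C}}$,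 i.e. $X/|X|\in\mathbb{S}^2$ composed with stereographic projection from the south pole. Formulas involving $p$ are read at points where $p\neq\infty$. *)

(* Defs.v *)
From HB Require Import structures.
From mathcomp Require Import all_boot all_order all_algebra.
From mathcomp Require Import all_classical all_reals all_analysis.
From mathcomp Require Import complex.

Set Implicit Arguments.
Unset Strict Implicit.
Unset Printing Implicit Defensive.

Import Order.TTheory GRing.Theory Num.Theory.
Import numFieldNormedType.Exports.

Local Open Scope classical_set_scope.
Local Open Scope ring_scope.

(* Points of R^n are row vectors. The norm that the library puts on 'rV[R]_n is
   the sup norm: it is used for the topology and for differentiability only,
   lengths are measured with [enorm] or with an explicit metric tensor. *)

Section Calculus.
Variable R : realType.

Definition partial (n : nat) (W : normedModType R) (i : 'I_n)
    (f : 'rV[R]_n -> W) : 'rV[R]_n -> W :=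
  fun x => 'D_(delta_mx 0 i) f x.

(* [n_times_differentiable k U f]: on the open set U, f and its iterated
   partial derivatives of order < k are (Frechet) differentiable. *)
Fixpoint n_times_differentiable (n : nat) (W : normedModType R) (k : nat)
    (U : set 'rV[R]_n) (f : 'rV[R]_n -> W) : Prop :=
  if k is k'.+1 then
    (forall x, U x -> differentiable f x) /\
    (forall i, n_times_differentiable k' U (partial i f))
  else True.

Definition smooth_on (n : nat) (W : normedModType R) (U : set 'rV[R]_n)
    (f : 'rV[R]_n -> W) : Prop :=
  forall k, n_times_differentiable k U f.

End Calculus.

(* Riemannian geometry in coordinates: a metric is given by its Gram matrix
   G x in the coordinate frame, i.e. (G x) i j = <d_i, d_j> at x. *)
Section CoordinateMetrics.
Variable R : realType.

Definition inner (n : nat) (G : 'M[R]_n) (v w : 'rV[R]_n) : R :=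
  (v *m G *m w^T) 0 0.

Definition is_metric_on (n : nat) (U : set 'rV[R]_n)
    (G : 'rV[R]_n -> 'M[R]_n) : Prop :=
  [/\ forall i j, smooth_on U (fun x => G x i j : R),
      forall x, U x -> (G x)^T = G x &
      forall x, U x -> forall v, v != 0 -> 0 < inner (G x) v v].

(* The library's jacobian acts on row vectors, ('J f x) i j = d_i f_j (x). *)
Definition pullback (m n : nat) (f : 'rV[R]_m -> 'rV[R]_n)
    (G : 'rV[R]_n -> 'M[R]_n) : 'rV[R]_m -> 'M[R]_m :=
  fun x => 'J f x *m G (f x) *m ('J f x)^T.

(* Gamma^k_{ij} *)
Definition christoffel (n : nat) (G : 'rV[R]_n -> 'M[R]_n) (k i j : 'I_n)
    (x : 'rV[R]_n) : R :=
  2^-1 * \sum_l invmx (G x) k l *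
    (partial i (fun y => G y j l : R) x + partial j (fun y => G y i l : R) x
     - partial l (fun y => G y i j : R) x).

(* R(d_i, d_j) d_k = \sum_l (riemann G l i j k) d_l, with the convention
   R(V, W) = [nabla_V, nabla_W] - nabla_[V, W]. *)
Definition riemann (n : nat) (G : 'rV[R]_n -> 'M[R]_n) (l i j k : 'I_n)
    (x : 'rV[R]_n) : R :=
  partial i (christoffel G l j k : _ -> R) x
  - partial j (christoffel G l i k : _ -> R) x
  + \sum_m (christoffel G m j k x * christoffel G l i m x
            - christoffel G m i k x * christoffel G l j m x).

(* <R(d_0, d_1) d_1, d_0> / (|d_0|^2 |d_1|^2 - <d_0, d_1>^2) *)
Definition gauss_curvature (G : 'rV[R]_2 -> 'M[R]_2) (x : 'rV[R]_2) : R :=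
  (\sum_l riemann G l 0 1 1 x * G x l 0) / \det (G x).

(* nabla_{d_i} (d_j Y) for the Levi-Civita connection of the ambient metric G *)
Definition cov_deriv (m n : nat) (G : 'rV[R]_n -> 'M[R]_n)
    (Y : 'rV[R]_m -> 'rV[R]_n) (i j : 'I_m) (x : 'rV[R]_m) : 'rV[R]_n :=
  \row_a (partial i (partial j Y) x 0 a +
    \sum_b \sum_c christoffel G a b c (Y x) * partial i Y x 0 b
                                            * partial j Y x 0 c).

End CoordinateMetrics.

(* S^2 x R is R^3 \ {0} with the metric |x|^-2 (dx1^2 + dx2^2 + dx3^2), where
   (y, t) corresponds to e^t y. *)
Section Ambient.
Variable R : realType.

Definition enorm (n : nat) (x : 'rV[R]_n) : R :=
  Num.sqrt (\sum_i x 0 i ^+ 2).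

Definition dmu2 (x : 'rV[R]_3) : 'M[R]_3 := (enorm x ^- 2)%:M.

Definition frameE (x : 'rV[R]_3) (j : 'I_3) : 'rV[R]_3 :=
  enorm x *: delta_mx 0 j.

Definition cross (v w : 'rV[R]_3) : 'rV[R]_3 :=
  let a : 'I_3 := inord 0 in let b : 'I_3 := inord 1 in
  let c : 'I_3 := inord 2 in
  (v 0 b * w 0 c - v 0 c * w 0 b) *: delta_mx 0 a +
  (v 0 c * w 0 a - v 0 a * w 0 c) *: delta_mx 0 b +
  (v 0 a * w 0 b - v 0 b * w 0 a) *: delta_mx 0 c.

(* The unit normal, in the coordinates x1, x2, x3 (not in the frame E). *)
Definition unit_normal (Y : 'rV[R]_2 -> 'rV[R]_3) (x : 'rV[R]_2) : 'rV[R]_3 :=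
  let w := cross (partial 0 Y x) (partial 1 Y x) in
  (Num.sqrt (inner (dmu2 (Y x)) w w))^-1 *: w.

(* (N_1, N_2, N_3); the frame E is orthonormal, so N_j = <N, E_j>. *)
Definition frame_normal (Y : 'rV[R]_2 -> 'rV[R]_3) (x : 'rV[R]_2) :
    'rV[R]_3 :=
  \row_j inner (dmu2 (Y x)) (unit_normal Y x) (frameE (Y x) j).

Definition second_form (Y : 'rV[R]_2 -> 'rV[R]_3) (x : 'rV[R]_2) : 'M[R]_2 :=
  \matrix_(i, j) inner (dmu2 (Y x)) (cov_deriv dmu2 Y i j x) (unit_normal Y x).

Definition mean_curvature (Y : 'rV[R]_2 -> 'rV[R]_3) (x : 'rV[R]_2) : R :=
  2^-1 * \tr (invmx (pullback Y dmu2 x) *m second_form Y x).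

End Ambient.

(* The extended complex plane is option R[i], with None for infinity. *)
Section ExtendedPlane.
Variable R : realType.
Local Open Scope complex_scope.

(* Stereographic projection of the unit sphere from (0, 0, -1). *)
Definition stereo (y : 'rV[R]_3) : option R[i] :=
  if 1 + y 0 (inord 2) == 0 then None
  else Some ((y 0 (inord 0) +i* y 0 (inord 1)) / (1 + y 0 (inord 2))%:C).

Definition finite_part (w : option R[i]) : R[i] := odflt 0 w.

(* A holomorphic chart of the extended plane at a: the identity if a is finite,
   w |-> 1/w if a is infinity. *)
Definition sphere_coord (a w : option R[i]) : R[i] :=
  if a is Some _ then finite_part w else
  if w is Some w' then w'^-1 else 0.

Definition to_plane (w : R[i]) : 'rV[R]_2 :=
  \row_j (if j == 0 then complex.Re w else complex.Im w).

(* f_z = (f_u - i f_v) / 2 in the coordinate z = u + iv *)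
Definition wirtinger (f : 'rV[R]_2 -> R[i]) (x : 'rV[R]_2) : R[i] :=
  let D k := partial k (fun y => complex.Re (f y) : R) x +i*
             partial k (fun y => complex.Im (f y) : R) x in
  (D 0 - 'i * D 1) / 2%:R.

End ExtendedPlane.

Section Surfaces.
Variable R : realType.

(* [cinv] is only meaningful on the image [cimg] of the coordinates. *)
Record chart (T : Type) := Chart {
  cdom : set T;
  cmap : T -> 'rV[R]_2;
  cinv : 'rV[R]_2 -> T
}.

Definition cimg (T : Type) (c : chart T) : set 'rV[R]_2 := cmap c @` cdom c.

Definition is_chart (T : topologicalType) (c : chart T) : Prop :=
  [/\ open (cdom c) /\ open (cimg c),
      forall q, cdom c q -> cinv c (cmap c q) = q,
      {within cdom c, continuous (cmap c)} &
      {within cimg c, continuous (cinv c)}].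

Definition overlap (T : Type) (c d : chart T) : set 'rV[R]_2 :=
  cmap c @` (cdom c `&` cdom d).

Definition transition (T : Type) (c d : chart T) : 'rV[R]_2 -> 'rV[R]_2 :=
  cmap d \o cinv c.

Definition oriented_compatible (T : Type) (c d : chart T) : Prop :=
  smooth_on (overlap c d) (transition c d) /\
  forall x, overlap c d x -> 0 < \det ('J (transition c d) x).

Definition conformal_metric_on (U : set 'rV[R]_2) (G : 'rV[R]_2 -> 'M[R]_2) :=
  forall x, U x -> exists2 l : R, 0 < l & G x = l%:M.

(* The atlas need not be maximal; [isothermal] records that the surface carries
   local conformal coordinates. *)
Record oriented_riemannian_surface := OrientedRiemannianSurface {
  surf :> topologicalType;
  surf_hausdorff : hausdorff_space surf;
  surf_second_countable : @second_countable surf;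
  atlas : set (chart surf);
  atlas_chart : forall c, atlas c -> is_chart c;
  atlas_compat : forall c d, atlas c -> atlas d -> oriented_compatible c d;
  metric : chart surf -> 'rV[R]_2 -> 'M[R]_2;
  metricP : forall c, atlas c -> is_metric_on (cimg c) (metric c);
  metric_change : forall c d, atlas c -> atlas d ->
    forall x, overlap c d x ->
      metric c x = pullback (transition c d) (metric d) x;
  isothermal : forall q, exists c,
    [/\ atlas c, cdom c q & conformal_metric_on (cimg c) (metric c)]
}.

Variable S : oriented_riemannian_surface.

Definition conformal_coordinate (c : chart S) : Prop :=
  atlas c /\ conformal_metric_on (cimg c) (metric c).

Definition smooth_map (X : S -> 'rV[R]_3) : Prop :=
  forall c, atlas c -> smooth_on (cimg c) (X \o cinv c).

Definition immersion (X : S -> 'rV[R]_3) : Prop :=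
  smooth_map X /\
  forall c, atlas c -> forall x, cimg c x -> row_free ('J (X \o cinv c) x).

(* X^* dmu2 is a positive multiple of the metric of S. *)
Definition conformal_map (X : S -> 'rV[R]_3) : Prop :=
  forall c, atlas c -> forall x, cimg c x ->
    exists2 l : R, 0 < l &
      pullback (X \o cinv c) (@dmu2 R) x = l *: metric c x.

Definition minimal (X : S -> 'rV[R]_3) : Prop :=
  forall c, atlas c -> forall x, cimg c x -> mean_curvature (X \o cinv c) x = 0.

(* The curvature and the Gauss map are computed in charts; their values do not
   depend on the chosen (oriented) chart. *)
Definition is_curvature (X : S -> 'rV[R]_3) (K : S -> R) : Prop :=
  forall c, atlas c -> forall q, cdom c q ->
    K q = gauss_curvature (pullback (X \o cinv c) (@dmu2 R)) (cmap c q).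

Definition is_gauss_map (X : S -> 'rV[R]_3) (g : S -> option R[i]) : Prop :=
  forall c, atlas c -> forall q, cdom c q ->
    g q = stereo (frame_normal (X \o cinv c) (cmap c q)).

Definition sphere_projection (X : S -> 'rV[R]_3) (q : S) : option R[i] :=
  stereo ((enorm (X q))^-1 *: X q).

(* g_z and (conj g)_z at q, in the coordinate z given by c; meaningful when
   g q <> None. *)
Definition g_z (c : chart S) (g : S -> option R[i]) (q : S) : R[i] :=
  wirtinger (fun x => finite_part (g (cinv c x))) (cmap c q).

Definition gbar_z (c : chart S) (g : S -> option R[i]) (q : S) : R[i] :=
  wirtinger (fun x => (finite_part (g (cinv c x)))^*%C) (cmap c q).

(* The differential of g at q, as a map into the extended plane, is not
   invertible. *)
Definition singular_point (g : S -> option R[i]) (q : S) : Prop :=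
  exists c, [/\ atlas c, cdom c q &
    'J (fun x => to_plane (sphere_coord (g q) (g (cinv c x)))) (cmap c q)
      \notin unitmx].

End Surfaces.

(* Main.v *)
Require Import Defs.
From mathcomp Require Import all_boot all_order all_algebra.
From mathcomp Require Import all_classical all_reals all_analysis.
From mathcomp Require Import complex ring lra.

(** The frame E_j is a multiple of the coordinate frame, so the Gauss map g is
    the stereographic projection of the Euclidean unit normal n of the surface
    in R^3, and everything can be expressed by Euclidean data.  In a conformal
    coordinate (u, v) on a patch Y write E = |Y_u|^2 = |Y_v|^2, r = |Y|^2,
    W = Y_u x Y_v = E n and h_ij = <Y_ij, W>, the Euclidean second fundamental
    form multiplied by E.  The proof rests on three facts.

    - Minimality for dmu^2 reads h_00 + h_11 = - 2 (E / r) <Y, W>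
      ([minimal_dot]): in the conformal metric dmu^2 = |x|^-2 dx^2 the Euclidean
      mean curvature is shifted by the normal derivative of log |x|.

    - The curvature of the induced metric is r times the Euclidean Gauss
      curvature, K = r (h_00 h_11 - h_01^2) / E^4 ([gauss_curvature_minimal]).
      Indeed the induced metric is (E / r) (du^2 + dv^2), whence
      K = - (r / 2E) Delta log (E / r).  The part - Delta log E is given by the
      Gauss equation of R^3, and log r is harmonic by minimality: up to a factor
      it is the height function of S^2 x R.

    - Stereographic projection is conformal with factor 1 / (1 + n_3), so
      |g_z|^2 = (h_00 + h_11)^2 / (4 E^3 (1 + n_3)^2) and
      |g_z|^2 - |gbar_z|^2 = (h_00 h_11 - h_01^2) / (E^3 (1 + n_3)^2)
      ([sqr_norm_gauss_derivative]).

    Hence K |g_z|^2 = nu^2 (|g_z|^2 - |gbar_z|^2), where nu = <n, Y / |Y|> is the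
    angle function.  The identity
    |g - p|^2 - |1 + conj(g) p|^2 = - nu (1 + |g|^2) (1 + |p|^2) of [stereo_dot]
    turns this into the formula of the theorem.

    The differential of g is singular exactly where h_00 h_11 - h_01^2 = 0
    ([det_jacobian_gauss_map]), also at g = infinity and at g_z = 0; this gives
    the second claim, once the singular point is moved from an arbitrary chart
    to a conformal one by the chain rule. *)

Set Implicit Arguments.
Unset Strict Implicit.
Unset Printing Implicit Defensive.

Import Order.TTheory GRing.Theory Num.Theory.
Import numFieldNormedType.Exports.

Local Open Scope classical_set_scope.
Local Open Scope ring_scope.

(** * Partial derivatives and Jacobians *)

Lemma differentiable_coord_comp (R : realType) (V : normedModType R) (m k : nat)
    (f : V -> 'M[R]_(m, k)) (x : V) a b :
  differentiable f x -> differentiable (fun y => f y a b : R) x.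
Proof.
by move=> df; exact: (differentiable_comp df (differentiable_coord _ _ _)).
Qed.

Section Partial.
Variables (R : realType) (n : nat).
Implicit Types (f g : 'rV[R]_n -> R) (i : 'I_n) (x : 'rV[R]_n).

Lemma partialD i f g x : differentiable f x -> differentiable g x ->
  partial i (fun y => f y + g y : R) x = partial i f x + partial i g x.
Proof. by move=> df dg; rewrite /partial deriveD //; exact: diff_derivable. Qed.

Lemma partialM i f g x : differentiable f x -> differentiable g x ->
  partial i (fun y => f y * g y : R) x
  = partial i f x * g x + f x * partial i g x.
Proof.
move=> df dg; rewrite /partial deriveM; try exact: diff_derivable.
by rewrite /GRing.scale /= addrC [g x * _]mulrC.
Qed.

Lemma partialV i f x : differentiable f x -> f x != 0 ->
  partial i (fun y => (f y)^-1 : R) x = - partial i f x / f x ^+ 2.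
Proof.
move=> df f0; rewrite /partial deriveV //; last exact: diff_derivable.
by rewrite /GRing.scale /= mulrC mulrN mulNr.
Qed.

Lemma partial_div i f g x :
  differentiable f x -> differentiable g x -> g x != 0 ->
  partial i (fun y => f y / g y : R) x
  = (partial i f x * g x - f x * partial i g x) / g x ^+ 2.
Proof.
move=> df dg g0; rewrite partialM ?partialV //; last exact: differentiableV.
by field.
Qed.

Lemma partial_cst i (c : R) x : partial i (fun=> c : R) x = 0.
Proof. exact: derive_cst. Qed.

Lemma eq_on_partial (W : normedModType R) (U : set 'rV[R]_n)
    (f g : 'rV[R]_n -> W) i x :
  open U -> U x -> (forall y, U y -> f y = g y) ->
  partial i f x = partial i g x.
Proof.
move=> oU Ux fg; apply: near_eq_derive.
by near=> y; apply: fg; near: y; exact: open_nbhs_nbhs.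
Unshelve. all: by end_near. Qed.

Lemma partial_coord (m k : nat) (f : 'rV[R]_n -> 'M[R]_(m, k)) i x a b :
  differentiable f x -> partial i (fun y => f y a b : R) x = partial i f x a b.
Proof.
by move=> df; rewrite /partial derive_mx ?mxE //; exact: diff_derivable.
Qed.

End Partial.

Lemma smooth_on_differentiable (R : realType) n (W : normedModType R)
    (U : set 'rV[R]_n) (f : 'rV[R]_n -> W) x :
  smooth_on U f -> U x -> differentiable f x.
Proof. by move=> /(_ 1%N) [df _]; exact: df. Qed.

Lemma smooth_on_partial (R : realType) n (W : normedModType R)
    (U : set 'rV[R]_n) i (f : 'rV[R]_n -> W) :
  smooth_on U f -> smooth_on U (partial i f).
Proof. by move=> sf k; have [_] := sf k.+1; exact. Qed.

Lemma differentiable_rV (R : realType) (V : normedModType R) n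
    (f : V -> 'rV[R]_n) x :
  (forall j, differentiable (fun y => f y 0 j : R) x) -> differentiable f x.
Proof.
move=> df.
have -> : f = \sum_j (fun y => f y 0 j *: (delta_mx 0 j : 'rV[R]_n)).
  by apply/funext => y; rewrite fct_sumE -row_sum_delta.
apply: differentiable_sum => j; exact: differentiableZl.
Qed.

(** Differentials are local; this allows a map given by a case analysis, such as
    a chart of the extended plane, to be replaced by a formula near a point. *)
Lemma near_eq_diff (R : realType) (V W : normedModType R) (f g : V -> W) (x : V) :
  (\near x, f x = g x) -> differentiable f x ->
  differentiable g x /\ 'd g x = 'd f x :> (V -> W).
Proof.
move=> fg df.
have fgx : f x = g x by exact: nbhs_singleton fg.
have E : g \o shift x = cst (g x) + 'd f x +o_ (0 : V) id.
  apply/eqaddoP => e e0.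
  have /eqaddoP/(_ e e0) := diff_locally df.
  move=> H; near=> h.
  rewrite /= !fctE /= -fgx.
  have -> : g (h + x) = f (h + x).
    apply/esym; near: h.
    move: fg; rewrite (near_shift 0 x).
    by apply: filterS => z /=; rewrite subr0.
  by near: h.
have dE := diff_unique (@diff_continuous _ _ _ _ _ df) E.
split; last exact: dE.
by apply/diff_locallyP; rewrite dE; split; [exact: diff_continuous|exact: E].
Unshelve. all: by end_near. Qed.

Lemma jacobianE (R : realType) n m (f : 'rV[R]_n -> 'rV[R]_m) x k a :
  differentiable f x -> 'J f x k a = partial k f x 0 a.
Proof. by move=> df; rewrite /partial deriveE // mxE. Qed.

Lemma jacobian_coord (R : realType) n m (f : 'rV[R]_n -> 'rV[R]_m) x k a :
  differentiable f x -> 'J f x k a = partial k (fun y => f y 0 a : R) x.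
Proof. by move=> df; rewrite jacobianE // partial_coord. Qed.

Lemma near_eq_jacobian (R : realType) m p (f g : 'rV[R]_m -> 'rV[R]_p) x :
  (\near x, f x = g x) -> differentiable f x ->
  differentiable g x /\ 'J g x = 'J f x.
Proof.
move=> fg df; have [dg gf] := near_eq_diff fg df; split; first exact: dg.
exact: (congr1 (@lin1_mx R m p) gf).
Qed.

Lemma jacobian_comp (R : realType) m n p (f : 'rV[R]_m -> 'rV[R]_n)
    (g : 'rV[R]_n -> 'rV[R]_p) x :
  differentiable f x -> differentiable g (f x) ->
  'J (g \o f) x = 'J f x *m 'J g (f x).
Proof.
move=> df dg; apply/row_matrixP => i.
by rewrite row_mul !rowE /jacobian !mul_rV_lin1 diff_comp.
Qed.

(** * Symmetry of second derivatives *)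

Section Schwarz.
Variables (R : realType) (n : nat).
Implicit Types (f : 'rV[R]_n -> R) (i j : 'I_n) (x : 'rV[R]_n).

Lemma is_derive_line f i x (t : R) :
  differentiable f (t *: delta_mx 0 i + x) ->
  is_derive t 1 (fun s : R => f (s *: delta_mx 0 i + x) : R)
    (partial i f (t *: delta_mx 0 i + x)).
Proof.
move=> /(@diff_derivable _ _ _ _ _ (delta_mx 0 i)).
rewrite /partial /derivable /derive => df.
have E : (fun h : R => h^-1 *: (((fun s : R => f (s *: delta_mx 0 i + x) : R)
     \o shift t) (h *: (1 : R)) - f (t *: delta_mx 0 i + x))) =
   (fun h : R => h^-1 *: ((f \o shift (t *: delta_mx 0 i + x)) (h *: delta_mx 0 i)
      - f (t *: delta_mx 0 i + x))).
  by apply/funext => h /=; rewrite [h *: 1]mulr1 scalerDl addrA.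
by split; rewrite /derivable /derive E.
Qed.

Let second_difference f i j x (h : R) : R :=
  f (h *: delta_mx 0 i + (h *: delta_mx 0 j + x)) - f (h *: delta_mx 0 i + x)
  - (f (h *: delta_mx 0 j + x) - f x).

Lemma second_differenceC f i j x h :
  second_difference f i j x h = second_difference f j i x h.
Proof.
rewrite /second_difference [h *: delta_mx 0 i + (_ + x)]addrCA.
by ring.
Qed.

Lemma norm_delta_mx i : `|delta_mx 0 i : 'rV[R]_n| <= 1.
Proof.
rewrite [`|_|]mx_normrE; apply: bigmax_le => //= -[a b] _.
by rewrite !mxE; case: (_ && _); rewrite ?normr1 ?normr0.
Qed.

(** By the mean value theorem in the direction i, the second difference is h times
    the variation of the i-th partial derivative over the step h e_j, and this
    variation is h times its j-th partial derivative, up to o(h). *)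
Lemma second_difference_le (U : set 'rV[R]_n) f i j x (e : R) :
  open U -> U x -> (forall y, U y -> differentiable f y) ->
  differentiable (partial i f) x -> 0 < e ->
  \forall h \near 0^'+, `|second_difference f i j x h
     - h ^+ 2 * partial j (partial i f) x| <= e * h ^+ 2.
Proof.
move=> oU Ux df dif e0.
have nU : nbhs x U by exact: open_nbhs_nbhs.
pose L := 'd (partial i f) x.
(* The linear approximation of partial i f is used at c e_i + h e_j and at c e_i,
   of norms at most 2h and h. *)
have e30 : 0 < e / 3 by rewrite divr_gt0.
have Hlin : \forall v \near (0 : 'rV[R]_n),
   `|partial i f (v + x) - partial i f x - L v| <= e / 3 * `|v|.
  have /eqaddoP/(_ _ e30) := diff_locally dif.
  apply: filterS => v /=; rewrite !fctE /=.
  by rewrite opprD addrA.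
have HU : \forall v \near (0 : 'rV[R]_n), U (v + x).
  have : \near x, U x by exact: nU.
  by rewrite (near_shift 0 x); apply: filterS => v /=; rewrite subr0.
have [d /= d0 Hd] := (nbhs_normP _ _).1 (filterI Hlin HU).
near=> h.
have h0 : 0 < h by near: h; exact: nbhs_right_gt.
have hd : h < d / 2 by near: h; apply: nbhs_right_lt; rewrite divr_gt0.
have smallD (a b : R) : 0 <= a <= h -> 0 <= b <= h ->
    let v : 'rV[R]_n := a *: delta_mx 0 i + b *: delta_mx 0 j in
    `|v| < d /\ `|v| <= a + b.
  move=> /andP[a0 ah] /andP[b0 bh] v.
  suff vab : `|v| <= a + b by split=> //; lra.
  apply: (le_trans (ler_normD _ _)); rewrite !normrZ !ger0_norm //.
  by apply: lerD; apply: ler_piMr => //; exact: norm_delta_mx.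
have inball (v : 'rV[R]_n) : `|v| < d ->
    `|partial i f (v + x) - partial i f x - L v| <= e / 3 * `|v| /\ U (v + x).
  by move=> vd; apply: Hd; rewrite /= sub0r normrN.
have [c /[!in_itv]/= /andP[c0 ch] cE] : exists2 c : R, c \in `]0, h[%R &
    second_difference f i j x h
    = (partial i f (c *: delta_mx 0 i + (h *: delta_mx 0 j + x))
      - partial i f (c *: delta_mx 0 i + x)) * h.
  pose phi (t : R) := f (t *: delta_mx 0 i + (h *: delta_mx 0 j + x))
    - f (t *: delta_mx 0 i + x) : R.
  have dphi t : 0 <= t <= h -> is_derive t 1 phi
     (partial i f (t *: delta_mx 0 i + (h *: delta_mx 0 j + x))
      - partial i f (t *: delta_mx 0 i + x)).
    move=> th; apply: is_deriveB; apply: is_derive_line; apply: df.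
      have [||vd _] := smallD t h => //; first by rewrite lexx ltW.
      by have [_] := inball _ vd; rewrite addrA.
    have [||vd _] := smallD t 0 => //; first by rewrite lexx ltW.
    by have [_] := inball _ vd; rewrite scale0r addr0.
  have [|||c c0h E] := @MVT R phi (fun t =>
      partial i f (t *: delta_mx 0 i + (h *: delta_mx 0 j + x))
      - partial i f (t *: delta_mx 0 i + x)) 0 h => //.
  - by move=> t /[!in_itv]/= /andP[t0 th]; apply: dphi; rewrite !ltW.
  - apply: derivable_within_continuous => t /[!in_itv]/= th.
    exact: (@ex_derive _ _ _ _ _ _ _ (dphi t th)).
  - exists c => //; move: E; rewrite subr0 => <-.
    by rewrite /phi scale0r !add0r.
have [||vd1 vn1] := smallD c h; [by rewrite !ltW|by rewrite lexx ltW|].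
have [||vd2 vn2] := smallD c 0; [by rewrite !ltW|by rewrite lexx ltW|].
have [B1 _] := inball _ vd1; have [B2 _] := inball _ vd2.
have Lj : L (delta_mx 0 j) = partial j (partial i f) x.
  by rewrite /partial -deriveE.
have Llin a b : L (a *: delta_mx 0 i + b *: delta_mx 0 j : 'rV[R]_n)
    = a * L (delta_mx 0 i) + b * L (delta_mx 0 j) :> R.
  by rewrite linearD !linearZ.
rewrite cE -Lj.
move: B1 B2; rewrite !Llin -(addrA (c *: _)) scale0r addr0 mul0r addr0.
rewrite scale0r addr0 addr0 in vn2.
set A1 := partial i f (c *: _ + (_ + _)); set A2 := partial i f (c *: _ + x).
set Li : R := L (delta_mx 0 i); set Lj' : R := L (delta_mx 0 j).
move=> B1' B2'.
have B1 := le_trans B1' (ler_wpM2l (ltW e30) vn1).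
have B2 := le_trans B2' (ler_wpM2l (ltW e30) vn2).
have -> : (A1 - A2) * h - h ^+ 2 * Lj'
   = ((A1 - partial i f x - (c * Li + h * Lj')) - (A2 - partial i f x - c * Li)) * h.
  by ring.
rewrite normrM (gtr0_norm h0) expr2 mulrA ler_pM2r //.
apply: le_trans (ler_normB _ _) _.
have /le_trans := lerD B1 B2; apply; rewrite -mulrDr mulrAC ler_pdivrMr // -mulrA ler_pM2l //.
lra.
Unshelve. all: by end_near. Qed.

(** The second difference is symmetric in i and j, and both mixed partial
    derivatives are its limit after division by h^2. *)
Lemma partialC (U : set 'rV[R]_n) f i j x :
  open U -> U x -> (forall y, U y -> differentiable f y) ->
  differentiable (partial i f) x -> differentiable (partial j f) x ->
  partial i (partial j f) x = partial j (partial i f) x.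
Proof.
move=> oU Ux df di dj.
have close (P Q : R) : (forall e : R, 0 < e -> exists h s : R,
    [/\ 0 < h, `|s - h ^+ 2 * P| <= e * h ^+ 2 & `|s - h ^+ 2 * Q| <= e * h ^+ 2]) ->
    Q = P.
  move=> H; apply/eqP; rewrite -subr_eq0 -normr_le0; apply/ler_addgt0Pr => e e0.
  have [|h [s [h0 HP HQ]]] := H (e / 2); first by rewrite divr_gt0.
  have h20 : 0 < h ^+ 2 by rewrite exprn_gt0.
  rewrite add0r -(ler_pM2l h20) -[X in X * `|_|](gtr0_norm h20) -normrM.
  have -> : h ^+ 2 * (Q - P) = (s - h ^+ 2 * P) - (s - h ^+ 2 * Q) by ring.
  apply: le_trans (ler_normB _ _) _; apply: le_trans (lerD HP HQ) _; lra.
apply: close => e e0.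
have [h [[h0 Hi] Hj]] := filter_ex (filterI (filterI (nbhs_right_gt (0 : R))
  (second_difference_le j oU Ux df di e0)) (second_difference_le i oU Ux df dj e0)).
exists h, (second_difference f i j x h); split; [exact: h0|exact: Hi|].
by rewrite second_differenceC; exact: Hj.
Qed.

End Schwarz.

Lemma smooth_partialC (R : realType) n m (U : set 'rV[R]_n)
    (f : 'rV[R]_n -> 'rV[R]_m) i j x :
  open U -> smooth_on U f -> U x ->
  partial i (partial j f) x = partial j (partial i f) x.
Proof.
move=> oU sf Ux.
have df k y (Uy : U y) := smooth_on_differentiable (smooth_on_partial k sf) Uy.
have cf k l a : partial l (fun y => partial k f y 0 a : R) x
    = partial l (partial k (fun y => f y 0 a : R) : _ -> R) x.
  apply: eq_on_partial oU Ux _ => y Uy.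
  by rewrite partial_coord //; exact: smooth_on_differentiable sf Uy.
have dpf k a : differentiable (partial k (fun y => f y 0 a : R) : _ -> R) x.
  apply: (near_eq_diff _ (differentiable_coord_comp 0 a (df k x Ux))).1.
  near=> y; rewrite partial_coord //; apply: smooth_on_differentiable sf _.
  by near: y; exact: open_nbhs_nbhs.
apply/rowP => a; rewrite -[LHS]partial_coord; last exact: df.
rewrite -[RHS]partial_coord; last exact: df.
rewrite !cf; apply: (partialC oU Ux).
- move=> y Uy; apply: differentiable_coord_comp.
  exact: smooth_on_differentiable sf Uy.
- exact: dpf.
- exact: dpf.
Unshelve. all: by end_near. Qed.

(** * Dot and cross products *)

Section DotProduct.
Variables (R : realType) (n : nat).
Implicit Types u v w : 'rV[R]_n.

Definition dot u v : R := \sum_i u 0 i * v 0 i.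

Lemma dotC u v : dot u v = dot v u.
Proof. by apply: eq_bigr => i _; rewrite mulrC. Qed.

Lemma dotZl a u v : dot (a *: u) v = a * dot u v.
Proof. by rewrite /dot mulr_sumr; apply: eq_bigr => i _; rewrite !mxE mulrA. Qed.

Lemma dotZr a u v : dot u (a *: v) = a * dot u v.
Proof. by rewrite dotC dotZl dotC. Qed.

Lemma dotDl u v w : dot (u + v) w = dot u w + dot v w.
Proof. by rewrite /dot -big_split; apply: eq_bigr => i _; rewrite !mxE mulrDl. Qed.

Lemma dotDr u v w : dot w (u + v) = dot w u + dot w v.
Proof. by rewrite dotC dotDl !(dotC w). Qed.

Lemma dotNl u v : dot (- u) v = - dot u v.
Proof. by rewrite -scaleN1r dotZl mulN1r. Qed.

Lemma dot_delta u i : dot u (delta_mx 0 i) = u 0 i.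
Proof.
rewrite /dot (bigD1 i) //= big1 ?addr0 ?mxE ?eqxx ?mulr1 // => j ji.
by rewrite mxE (negPf ji) andbF mulr0.
Qed.

Lemma enorm_dot u : enorm u ^+ 2 = dot u u.
Proof. by rewrite sqr_sqrtr // sumr_ge0 // => i _; exact: sqr_ge0. Qed.

Lemma dot_gt0 u : u != 0 -> 0 < dot u u.
Proof.
move=> u0; rewrite lt0r; apply/andP; split; last first.
  by rewrite sumr_ge0 // => i _; exact: sqr_ge0.
apply: contraNneq u0 => /eqP.
rewrite psumr_eq0 => [/allP u0|i _]; last exact: sqr_ge0.
apply/eqP/rowP => i; rewrite mxE; apply/eqP.
by have := u0 i (mem_index_enum _); rewrite mulf_eq0 orbb.
Qed.

Lemma inner_scalar a u v : inner (a%:M) u v = a * dot u v.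
Proof.
rewrite /inner mul_mx_scalar -scalemxAl mxE; congr (_ * _).
by rewrite mxE; apply: eq_bigr => i _; rewrite mxE.
Qed.

Lemma differentiable_dot (V : normedModType R) (f g : V -> 'rV[R]_n) x :
  differentiable f x -> differentiable g x ->
  differentiable (fun y => dot (f y) (g y)) x.
Proof.
move=> df dg.
have -> : (fun y => dot (f y) (g y)) = \sum_i (fun y => f y 0 i * g y 0 i : R).
  by apply/funext => y; rewrite /dot fct_sumE.
by apply: differentiable_sum => i;
   apply: differentiableM; exact: differentiable_coord_comp.
Qed.

Lemma partial_dot m (k : 'I_m) (f g : 'rV[R]_m -> 'rV[R]_n) x :
  differentiable f x -> differentiable g x ->
  partial k (fun y => dot (f y) (g y) : R) x
  = dot (partial k f x) (g x) + dot (f x) (partial k g x).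
Proof.
move=> df dg.
have E : (fun y => dot (f y) (g y) : R) = \sum_i (fun y => f y 0 i * g y 0 i : R).
  by apply/funext => y; rewrite /dot fct_sumE.
have df' i := differentiable_coord_comp 0 i df.
have dg' i := differentiable_coord_comp 0 i dg.
rewrite E /partial derive_sum => [|i]; last first.
  by apply: diff_derivable; apply: differentiableM.
rewrite -big_split; apply: eq_bigr => i _ /=.
by rewrite -!/(partial _ _ _) partialM // !partial_coord.
Qed.

End DotProduct.

Section CrossProduct.
Variable R : realType.
Implicit Types a b c d p q : 'rV[R]_3.

Local Notation i0 := (inord 0 : 'I_3).
Local Notation i1 := (inord 1 : 'I_3).
Local Notation i2 := (inord 2 : 'I_3).

Lemma dot3E a b :
  dot a b = a 0 i0 * b 0 i0 + a 0 i1 * b 0 i1 + a 0 i2 * b 0 i2.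
Proof.
rewrite /dot !big_ord_recl big_ord0 addr0 addrA.
have e0 : ord0 = i0 by apply/val_inj; rewrite /= inordK.
have e1 : lift ord0 ord0 = i1 by apply/val_inj; rewrite /= inordK.
have e2 : lift ord0 (lift ord0 ord0) = i2 by apply/val_inj; rewrite /= inordK.
by rewrite -e0 -e1 -e2.
Qed.

Lemma cross0 a b : cross a b 0 i0 = a 0 i1 * b 0 i2 - a 0 i2 * b 0 i1.
Proof. by rewrite !mxE -!val_eqE /= !inordK //=; ring. Qed.

Lemma cross1 a b : cross a b 0 i1 = a 0 i2 * b 0 i0 - a 0 i0 * b 0 i2.
Proof. by rewrite !mxE -!val_eqE /= !inordK //=; ring. Qed.

Lemma cross2 a b : cross a b 0 i2 = a 0 i0 * b 0 i1 - a 0 i1 * b 0 i0.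
Proof. by rewrite !mxE -!val_eqE /= !inordK //=; ring. Qed.

Let crossE := (cross0, cross1, cross2).

Lemma dot_cross_l a b : dot (cross a b) a = 0.
Proof. by rewrite dot3E !crossE; ring. Qed.

Lemma dot_cross_r a b : dot (cross a b) b = 0.
Proof. by rewrite dot3E !crossE; ring. Qed.

Lemma dot_cross_cross a b c d :
  dot (cross a b) (cross c d) = dot a c * dot b d - dot a d * dot b c.
Proof. by rewrite !dot3E !crossE; ring. Qed.

(** The product of two triple products is a Gram determinant.  For an orthogonal
    pair p, q of the same length, this is the Parseval identity in the orthogonal
    basis p, q, cross p q, without division. *)
Lemma parseval p q a b E : dot p p = E -> dot q q = E -> dot p q = 0 ->
  E ^+ 2 * dot a b = E * (dot a p * dot b p + dot a q * dot b q)
    + dot a (cross p q) * dot b (cross p q).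
Proof.
move=> pE qE pq0.
have gram : dot a (cross p q) * dot b (cross p q) =
    dot a b * (dot p p * dot q q - dot p q ^+ 2)
    - dot a p * (dot b p * dot q q - dot p q * dot b q)
    + dot a q * (dot b p * dot p q - dot p p * dot b q).
  by rewrite !dot3E !crossE; ring.
by rewrite gram pE qE pq0; ring.
Qed.

Lemma differentiable_cross (V : normedModType R) (f g : V -> 'rV[R]_3) x :
  differentiable f x -> differentiable g x ->
  differentiable (fun y => cross (f y) (g y)) x.
Proof.
move=> df dg; rewrite /cross.
have df' i := differentiable_coord_comp 0 i df.
have dg' i := differentiable_coord_comp 0 i dg.
by do 2?apply: differentiableD; apply: differentiableZl;
   apply: differentiableB; apply: differentiableM.
Qed.

End CrossProduct.

(** * Conformally flat metrics *)

Lemma ord2P (k : 'I_2) : k = 0 \/ k = 1.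
Proof. by case: k => [[|[|k]] lk]; [left; apply/val_inj|right; apply/val_inj|]. Qed.

Lemma sum2E (R : nmodType) (F : 'I_2 -> R) : \sum_i F i = F 0 + F 1.
Proof.
rewrite !big_ord_recl big_ord0 addr0.
by congr (F _ + F _); exact/val_inj.
Qed.

Lemma det2E (F : comPzRingType) (A : 'M[F]_2) :
  \det A = A 0 0 * A 1 1 - A 0 1 * A 1 0.
Proof.
rewrite (expand_det_row _ 0) !big_ord_recl big_ord0 /cofactor !det_mx11 !mxE /=.
have -> : lift 0 0 = 1 :> 'I_2 by apply/val_inj.
have -> : lift 1 0 = 0 :> 'I_2 by apply/val_inj.
by rewrite /= expr0 expr1; ring.
Qed.

Lemma sum_delta (R : pzRingType) n (a : 'I_n) (F : 'I_n -> R) :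
  \sum_b (b == a)%:R * F b = F a.
Proof.
rewrite (bigD1 a) //= eqxx mul1r big1 ?addr0 // => b ba.
by rewrite (negPf ba) mul0r.
Qed.

Section ConformalMetric.
Variable R : realType.

(** The functions psi a are the derivatives of log (phi) / 2; the
    Christoffel symbols of a conformally flat metric are linear in them, with
    constant coefficients. *)
Lemma christoffel_conformal n (U : set 'rV[R]_n) (G : 'rV[R]_n -> 'M[R]_n)
    (phi : 'rV[R]_n -> R) (psi : 'I_n -> R) (k i j : 'I_n) x :
  open U -> (forall y, U y -> G y = (phi y)%:M) -> U x -> phi x != 0 ->
  (forall a, partial a (phi : _ -> R) x = 2 * phi x * psi a) ->
  christoffel G k i j x
  = (j == k)%:R * psi i + (i == k)%:R * psi j - (i == j)%:R * psi k.
Proof.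
move=> oU GU Ux phi0 dphi.
have dG a b l : partial a (fun y => G y b l : R) x
    = (b == l)%:R * (2 * phi x * psi a).
  rewrite -dphi (eq_on_partial (g := fun y => phi y *+ (b == l) : R) a oU Ux).
    case: (b == l); last by rewrite mul0r; exact: partial_cst.
    by rewrite mul1r.
  by move=> y Uy; rewrite GU // mxE.
rewrite /christoffel (bigD1 k) //= big1 => [|l lk]; last first.
  by rewrite GU // invmx_scalar !mxE eq_sym (negPf lk) mulr0n mul0r.
rewrite !dG addr0 GU // invmx_scalar !mxE eqxx mulr1n.
by field.
Qed.

(** This is K = - Delta (log phi) / (2 phi), with the half logarithmic derivatives
    psi supplied by the caller so that each can be written in a convenient way. *)
Lemma gauss_curvature_conformal (U : set 'rV[R]_2) (G : 'rV[R]_2 -> 'M[R]_2)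
    (phi : 'rV[R]_2 -> R) (psi : 'I_2 -> 'rV[R]_2 -> R) x :
  open U -> (forall y, U y -> G y = (phi y)%:M) ->
  (forall y, U y -> phi y != 0) ->
  (forall a y, U y -> partial a (phi : _ -> R) y = 2 * phi y * psi a y) ->
  U x -> (forall a, differentiable (psi a) x) ->
  gauss_curvature G x
  = - (partial 0 (psi 0 : _ -> R) x + partial 1 (psi 1 : _ -> R) x) / phi x.
Proof.
move=> oU GU phi0 dphi Ux dpsi.
have Gam k i j y : U y -> christoffel G k i j y =
    (j == k)%:R * psi i y + (i == k)%:R * psi j y - (i == j)%:R * psi k y.
  move=> Uy; exact: (christoffel_conformal (psi := psi^~ y) k i j oU GU Uy
    (phi0 y Uy) (fun a => dphi a y Uy)).
have dN a b : partial b (fun y => - psi a y : R) x = - partial b (psi a : _ -> R) x.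
  by rewrite /partial deriveN //; exact: diff_derivable.
rewrite /gauss_curvature sum2E GU // det_scalar !mxE /= mulr1n mulr0n mulr0 addr0.
rewrite /riemann sum2E.
rewrite (eq_on_partial (g := fun y => - psi 0 y : R) (0 : 'I_2) oU Ux); last first.
  by move=> y Uy; rewrite Gam //=; ring.
rewrite (eq_on_partial (g := psi 1 : _ -> R) (1 : 'I_2) oU Ux); last first.
  by move=> y Uy; rewrite Gam //=; ring.
rewrite dN !Gam //=; field; exact: phi0.
Qed.

End ConformalMetric.

Section Ambient.
Variable R : realType.
Implicit Types y : 'rV[R]_3.

Lemma dmu2E y : dmu2 y = ((dot y y)^-1)%:M.
Proof. by rewrite /dmu2 enorm_dot. Qed.

Lemma partial_dmu2 y (a : 'I_3) : y != 0 ->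
  partial a (fun z => (dot z z)^-1 : R) y
  = 2 * (dot y y)^-1 * (- y 0 a / dot y y).
Proof.
move=> y0; have r0 := lt0r_neq0 (dot_gt0 y0).
have di : differentiable (@id 'rV[R]_3) y by exact: ex_diff.
rewrite partialV //; last exact: differentiable_dot.
rewrite partial_dot // /partial derive_id dot_delta dotC dot_delta.
by field.
Qed.

Lemma christoffel_dmu2 y (k i j : 'I_3) : y != 0 ->
  christoffel (@dmu2 R) k i j y = - (dot y y)^-1 *
    ((j == k)%:R * y 0 i + (i == k)%:R * y 0 j - (i == j)%:R * y 0 k).
Proof.
move=> y0; have r0 := lt0r_neq0 (dot_gt0 y0).
rewrite (christoffel_conformal (U := setT) (phi := fun z => (dot z z)^-1 : R)
  (psi := fun a => - y 0 a / dot y y)) ?invr_eq0 //; first by ring.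
- exact: openT.
- by move=> z _; exact: dmu2E.
- by move=> a; exact: partial_dmu2.
Qed.

(** When v and w are tangent to a surface, only the last term, along the position
    vector y, contributes to the second fundamental form. *)
Lemma christoffel_dmu2_contract y (v w : 'rV[R]_3) a : y != 0 ->
  \sum_b \sum_c christoffel (@dmu2 R) a b c y * v 0 b * w 0 c
  = - (dot y y)^-1 * (dot y v * w 0 a + dot y w * v 0 a - dot v w * y 0 a).
Proof.
move=> y0; transitivity (\sum_b (- (dot y y)^-1 *
    (y 0 b * v 0 b * w 0 a + (b == a)%:R * (dot y w * v 0 b) - v 0 b * w 0 b * y 0 a))).
  apply: eq_bigr => b _.
  rewrite -[w 0 a](sum_delta a (fun c => w 0 c)) -[v 0 b * w 0 b]mulrC.
  rewrite -[w 0 b * v 0 b](sum_delta b (fun c => w 0 c * v 0 b)).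
  rewrite {1}/dot !(mulr_sumr, mulr_suml) -big_split -sumrB mulr_sumr.
  apply: eq_bigr => c _; rewrite christoffel_dmu2 //= (eq_sym b c).
  by ring.
by rewrite -mulr_sumr sumrB big_split /= sum_delta -!mulr_suml.
Qed.

Lemma cov_deriv_dmu2 (Y : 'rV[R]_2 -> 'rV[R]_3) i j x : Y x != 0 ->
  cov_deriv (@dmu2 R) Y i j x = partial i (partial j Y) x
   - (dot (Y x) (Y x))^-1 *: (dot (Y x) (partial i Y x) *: partial j Y x
       + dot (Y x) (partial j Y x) *: partial i Y x
       - dot (partial i Y x) (partial j Y x) *: Y x).
Proof.
move=> Y0; apply/rowP => a; rewrite [LHS]mxE christoffel_dmu2_contract //.
move: (partial i (partial j Y) x) (partial i Y x) (partial j Y x) => u v w.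
by rewrite !mxE mulNr.
Qed.

Lemma pullback_dmu2 n (Y : 'rV[R]_n -> 'rV[R]_3) x i j :
  differentiable Y x ->
  pullback Y (@dmu2 R) x i j
  = (dot (Y x) (Y x))^-1 * dot (partial i Y x) (partial j Y x).
Proof.
move=> dY; rewrite /pullback dmu2E mul_mx_scalar -scalemxAl mxE; congr (_ * _).
by rewrite mxE; apply: eq_bigr => a _; rewrite [_^T _ _]mxE !jacobianE.
Qed.

End Ambient.

(** * Stereographic projection *)

(** For m on the unit sphere and a tangent to it, the left-hand side is the squared
    length of the image of a under the differential of stereographic projection,
    cleared of denominators: the projection scales lengths by 1 / t. *)
Lemma stereo_conformal (F : fieldType) (m0 m1 m2 a0 a1 a2 : F) (t := 1 + m2) :
  m0 ^+ 2 + m1 ^+ 2 + m2 ^+ 2 = 1 -> m0 * a0 + m1 * a1 + m2 * a2 = 0 ->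
  (a0 * t - m0 * a2) ^+ 2 + (a1 * t - m1 * a2) ^+ 2
  = t ^+ 2 * (a0 ^+ 2 + a1 ^+ 2 + a2 ^+ 2).
Proof.
move=> mm ma; apply/eqP; rewrite -subr_eq0 /t; apply/eqP.
transitivity (a2 ^+ 2 * (m0 ^+ 2 + m1 ^+ 2 + m2 ^+ 2 - 1)
  - 2 * (1 + m2) * a2 * (m0 * a0 + m1 * a1 + m2 * a2)); first by ring.
by rewrite mm ma; ring.
Qed.

(** With [stereo_conformal]: stereographic projection from the south pole preserves
    the orientation given by the outward normal m. *)
Lemma stereo_orientation (F : fieldType) (m0 m1 m2 a0 a1 a2 b0 b1 b2 : F)
    (t := 1 + m2) :
  m0 ^+ 2 + m1 ^+ 2 + m2 ^+ 2 = 1 -> m0 * a0 + m1 * a1 + m2 * a2 = 0 ->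
  m0 * b0 + m1 * b1 + m2 * b2 = 0 ->
  (a0 * t - m0 * a2) * (b1 * t - m1 * b2) - (b0 * t - m0 * b2) * (a1 * t - m1 * a2)
  = t ^+ 2 * (m0 * (a1 * b2 - a2 * b1) + m1 * (a2 * b0 - a0 * b2)
              + m2 * (a0 * b1 - a1 * b0)).
Proof.
move=> mm ma mb; apply/eqP; rewrite -subr_eq0 /t; apply/eqP.
set mmE := m0 ^+ 2 + _ + _ in mm; set maE := m0 * a0 + _ + _ in ma.
set mbE := m0 * b0 + _ + _ in mb.
transitivity (t * ((a0 * b1 - a1 * b0) * (1 - mmE)
    + m0 * (b1 * maE - a1 * mbE) - m1 * (b0 * maE - a0 * mbE))).
  by rewrite /t /mmE /maE /mbE; ring.
by rewrite mm ma mb; ring.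
Qed.

(** The rotation (n_0, n_1, n_2) -> (n_0, - n_1, - n_2) exchanges the two poles
    and preserves triple products. *)
Lemma triple_flip (F : comPzRingType) (m0 m1 m2 a0 a1 a2 b0 b1 b2 : F) :
  m0 * (- a1 * - b2 - - a2 * - b1) + - m1 * (- a2 * b0 - a0 * - b2)
  + - m2 * (a0 * - b1 - - a1 * b0)
  = m0 * (a1 * b2 - a2 * b1) + m1 * (a2 * b0 - a0 * b2) + m2 * (a0 * b1 - a1 * b0).
Proof. by ring. Qed.

(** Here (n0, n1, n2) is a map into the unit sphere with partial derivatives
    (a0 i, a1 i, a2 i), and u + iv is its stereographic projection. *)
Section Coordinates.
Variables (R : realType) (n0 n1 n2 : 'rV[R]_2 -> R) (x : 'rV[R]_2).
Hypotheses (d0 : differentiable n0 x) (d1 : differentiable n1 x).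
Hypotheses (d2 : differentiable n2 x).
Hypothesis nn : n0 x ^+ 2 + n1 x ^+ 2 + n2 x ^+ 2 = 1.
Variables (a0 a1 a2 : 'I_2 -> R).
Hypothesis da0 : forall i, partial i (n0 : _ -> R) x = a0 i.
Hypothesis da1 : forall i, partial i (n1 : _ -> R) x = a1 i.
Hypothesis da2 : forall i, partial i (n2 : _ -> R) x = a2 i.
Hypothesis na : forall i, n0 x * a0 i + n1 x * a1 i + n2 x * a2 i = 0.
Hypothesis t0 : 1 + n2 x != 0.

Let u y : R := n0 y / (1 + n2 y).
Let v y : R := n1 y / (1 + n2 y).

Let dt : differentiable (fun y => 1 + n2 y : R) x.
Proof. by apply: differentiableD. Qed.

Lemma differentiable_stereo (f : 'rV[R]_2 -> R) : differentiable f x ->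
  differentiable (fun y => f y / (1 + n2 y) : R) x.
Proof. by move=> df; apply: differentiableM => //; exact: differentiableV. Qed.

Let partial_stereo (f : 'rV[R]_2 -> R) i : differentiable f x ->
  partial i (fun y => f y / (1 + n2 y) : R) x
  = (partial i (f : _ -> R) x * (1 + n2 x) - f x * a2 i) / (1 + n2 x) ^+ 2.
Proof.
by move=> df; rewrite partial_div // partialD // partial_cst add0r da2.
Qed.

Lemma stereo_partial_norm i :
  partial i (u : _ -> R) x ^+ 2 + partial i (v : _ -> R) x ^+ 2
  = (a0 i ^+ 2 + a1 i ^+ 2 + a2 i ^+ 2) / (1 + n2 x) ^+ 2.
Proof.
rewrite /u /v !partial_stereo // da0 da1 !expr_div_n -mulrDl.
by rewrite stereo_conformal //; field.
Qed.

Lemma stereo_jacobian :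
  partial 0 (u : _ -> R) x * partial 1 (v : _ -> R) x
  - partial 1 (u : _ -> R) x * partial 0 (v : _ -> R) x
  = (n0 x * (a1 0 * a2 1 - a2 0 * a1 1) + n1 x * (a2 0 * a0 1 - a0 0 * a2 1)
     + n2 x * (a0 0 * a1 1 - a1 0 * a0 1)) / (1 + n2 x) ^+ 2.
Proof.
rewrite /u /v !partial_stereo // !da0 !da1.
transitivity (((a0 0 * (1 + n2 x) - n0 x * a2 0) * (a1 1 * (1 + n2 x) - n1 x * a2 1)
   - (a0 1 * (1 + n2 x) - n0 x * a2 1) * (a1 0 * (1 + n2 x) - n1 x * a2 0))
   / (1 + n2 x) ^+ 4); first by field.
by rewrite (stereo_orientation nn (na 0) (na 1)); field.
Qed.

End Coordinates.

Section ComplexValued.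
Variable R : realType.
Local Open Scope complex_scope.

(** At the south pole, the value of [finite_part] at infinity agrees with the
    convention x / 0 = 0. *)
Lemma stereo_Re (n : 'rV[R]_3) :
  complex.Re (finite_part (stereo n)) = n 0 (inord 0) / (1 + n 0 (inord 2)).
Proof.
rewrite /stereo; case: eqP => [->|_]; first by rewrite /= invr0 mulr0.
by rewrite -fmorphV /= mulr0 subr0.
Qed.

Lemma stereo_Im (n : 'rV[R]_3) :
  complex.Im (finite_part (stereo n)) = n 0 (inord 1) / (1 + n 0 (inord 2)).
Proof.
rewrite /stereo; case: eqP => [->|_]; first by rewrite /= invr0 mulr0.
by rewrite -fmorphV /= mulr0 add0r.
Qed.

Lemma sqr_norm_wirtinger (U : set 'rV[R]_2) (f : 'rV[R]_2 -> R[i])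
    (u v : 'rV[R]_2 -> R) x : open U -> U x ->
  (forall y, U y -> complex.Re (f y) = u y) ->
  (forall y, U y -> complex.Im (f y) = v y) ->
  `|wirtinger f x| ^+ 2 =
    (((partial 0 (u : _ -> R) x + partial 1 (v : _ -> R) x) ^+ 2
     + (partial 0 (v : _ -> R) x - partial 1 (u : _ -> R) x) ^+ 2) / 4)%:C.
Proof.
move=> oU Ux fu fv; rewrite /wirtinger -complexiE.
rewrite (eq_on_partial 0 oU Ux fu) (eq_on_partial 1 oU Ux fu).
rewrite (eq_on_partial 0 oU Ux fv) (eq_on_partial 1 oU Ux fv).
move: (partial 0 u x) (partial 1 u x) (partial 0 v x) (partial 1 v x) => a b c d.
have -> : (a +i* c - 'i * (b +i* d)) / 2%:R = ((a + d) / 2) +i* ((c - b) / 2).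
  rewrite (_ : (2%:R : R[i]) = 2%:R%:C); last by rewrite rmorph_nat.
  rewrite -fmorphV.
  by apply/eqP; rewrite eq_complex /=; apply/andP; split; apply/eqP; ring.
by rewrite -add_Re2_Im2 /=; congr (_%:C); field.
Qed.

Lemma stereo_Some (n : 'rV[R]_3) (w : R[i]) : stereo n = Some w ->
  1 + n 0 (inord 2) != 0 /\
  w = (n 0 (inord 0) / (1 + n 0 (inord 2))) +i* (n 0 (inord 1) / (1 + n 0 (inord 2))).
Proof.
move=> nw; split; first by move: nw; rewrite /stereo; case: eqP.
by rewrite -stereo_Re -stereo_Im nw /=; case: w {nw}.
Qed.

(** The point of the sphere with stereographic coordinate g has the coordinates
    2 Re g, 2 Im g and 1 - |g|^2, divided by 1 + |g|^2; expanding the left-hand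
    side gives minus the scalar product of two such triples. *)
Lemma stereo_dot (m y : 'rV[R]_3) (g p : R[i]) :
  dot m m = 1 -> dot y y = 1 -> stereo m = Some g -> stereo y = Some p ->
  `|g - p| ^+ 2 - `|1 + g^* * p| ^+ 2
  = - (dot m y)%:C * ((1 + `|g| ^+ 2) * (1 + `|p| ^+ 2)).
Proof.
rewrite !dot3E => mm yy /stereo_Some[t0 ->] /stereo_Some[s0 ->].
move: (m 0 (inord 0)) (m 0 (inord 1)) (m 0 (inord 2)) mm t0 => m0 m1 m2 mm t0.
move: (y 0 (inord 0)) (y 0 (inord 1)) (y 0 (inord 2)) yy s0 => y0 y1 y2 yy s0.
rewrite -!add_Re2_Im2 /= -!rmorphB -!(rmorphD _ 1) -!rmorphN -!rmorphM /=.
congr (_%:C).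
have m0E : m0 ^+ 2 = 1 - m1 ^+ 2 - m2 ^+ 2 by rewrite -mm; ring.
have y0E : y0 ^+ 2 = 1 - y1 ^+ 2 - y2 ^+ 2 by rewrite -yy; ring.
have -> : 1 + ((m0 / (1 + m2)) ^+ 2 + (m1 / (1 + m2)) ^+ 2) = 2 / (1 + m2).
  by rewrite expr_div_n m0E; field.
have -> : 1 + ((y0 / (1 + y2)) ^+ 2 + (y1 / (1 + y2)) ^+ 2) = 2 / (1 + y2).
  by rewrite expr_div_n y0E; field.
transitivity ((m0 ^+ 2 + m1 ^+ 2) / (1 + m2) ^+ 2 + (y0 ^+ 2 + y1 ^+ 2) / (1 + y2) ^+ 2
   - 1 - (m0 ^+ 2 + m1 ^+ 2) * (y0 ^+ 2 + y1 ^+ 2) / ((1 + m2) ^+ 2 * (1 + y2) ^+ 2)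
   - 4 * (m0 * y0 + m1 * y1) / ((1 + m2) * (1 + y2))).
  by field; rewrite t0 s0.
by rewrite m0E y0E; field; rewrite t0 s0.
Qed.

(** Followed by w -> 1 / w, the projection from the south pole is the conjugate of
    the projection from the north pole. *)
Lemma stereo_south (n : 'rV[R]_3) :
  n 0 (inord 0) ^+ 2 + n 0 (inord 1) ^+ 2 + n 0 (inord 2) ^+ 2 = 1 ->
  n 0 (inord 2) != 1 ->
  sphere_coord None (stereo n)
  = Complex (n 0 (inord 0) / (1 - n 0 (inord 2))) (- n 0 (inord 1) / (1 - n 0 (inord 2))).
Proof.
move=> nn n21; have s0 : 1 - n 0 (inord 2) != 0 by rewrite subr_eq0 eq_sym.
move: nn s0; case E : (stereo n) => [w|] /=.
  have [t0 ->] := stereo_Some E.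
  move: (n 0 (inord 0)) (n 0 (inord 1)) (n 0 (inord 2)) t0 => a b c t0 nn s0.
  set w' := Complex _ _; set z := Complex _ _.
  have wz : w' * z = 1.
    have ab : a ^+ 2 + b ^+ 2 = (1 + c) * (1 - c) by rewrite -[LHS](addrK (c ^+ 2)) nn; ring.
    apply/eqP; rewrite eq_complex /=; apply/andP; split; apply/eqP.
      transitivity ((a ^+ 2 + b ^+ 2) / ((1 + c) * (1 - c))); first by field; rewrite t0 s0.
      by rewrite ab mulfV // mulf_neq0.
    by field; rewrite t0 s0.
  have w0 : w' != 0 by apply: contra_eq_neq wz => ->; rewrite mul0r eq_sym oner_eq0.
  by apply: (mulfI w0); rewrite wz mulfV.
move: E; rewrite /stereo; case: eqP => // /eqP; rewrite addrC addr_eq0 => /eqP -> _.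
rewrite sqrrN expr1n => /eqP; rewrite -subr_eq0 addrK paddr_eq0 ?sqr_ge0 //.
by rewrite !sqrf_eq0 => /andP[/eqP -> /eqP ->] _; rewrite oppr0 !mul0r.
Qed.

End ComplexValued.

Section PlaneMaps.
Variables (R : realType) (u v : 'rV[R]_2 -> R) (x : 'rV[R]_2).
Hypotheses (du : differentiable u x) (dv : differentiable v x).

Lemma differentiable_to_plane :
  differentiable (fun y => to_plane (Complex (u y) (v y))) x.
Proof.
apply: differentiable_rV => j; have [->|->] := ord2P j.
  by under eq_fun do rewrite mxE /=.
by under eq_fun do rewrite mxE /=.
Qed.

Lemma det_jacobian_to_plane :
  \det ('J (fun y => to_plane (Complex (u y) (v y))) x)
  = partial 0 (u : _ -> R) x * partial 1 (v : _ -> R) x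
    - partial 1 (u : _ -> R) x * partial 0 (v : _ -> R) x.
Proof.
have dP := differentiable_to_plane.
have P0 : (fun y => to_plane (Complex (u y) (v y)) 0 0 : R) = u.
  by apply/funext => y; rewrite mxE.
have P1 : (fun y => to_plane (Complex (u y) (v y)) 0 1 : R) = v.
  by apply/funext => y; rewrite mxE.
have J i j := jacobian_coord i j dP.
rewrite det2E (J 0 0) (J 0 1) (J 1 0) (J 1 1) P0 P1.
by rewrite [X in _ - X]mulrC.
Qed.

End PlaneMaps.

(** * Conformal minimal patches *)

(** Here (a, b, c) is (h_00, h_01, h_11), (d, n) is (<Y_uu, Y_vv>, |Y_uv|^2),
    (al, be) is (<Y_v, Y_uv>, <Y_u, Y_uv>), (s, y0, y1) are the products of Y with
    W, Y_u, Y_v, (l0, l1) those of Y with Y_uu, Y_vv, and t0, t1 contain the third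
    derivatives.  The hypotheses are Parseval identities, minimality and the
    twice differentiated relation <Y_u, Y_v> = 0. *)
Lemma curvature_algebra (F : fieldType) (E r al be a b c d n s y0 y1 l0 l1 t0 t1 : F) :
  E != 0 -> r != 0 ->
  E ^+ 2 * d = a * c - E * (al ^+ 2 + be ^+ 2) ->
  E ^+ 2 * n = b ^+ 2 + E * (al ^+ 2 + be ^+ 2) ->
  E ^+ 2 * r = E * (y0 ^+ 2 + y1 ^+ 2) + s ^+ 2 ->
  E ^+ 2 * (l0 + l1) = s * (a + c) -> a + c = - 2 * E / r * s ->
  t0 + d + n + t1 = 0 ->
  - (((n + t0) / E - 2 * al ^+ 2 / E ^+ 2 - (E + l0) / r + 2 * y0 ^+ 2 / r ^+ 2)
   + ((n + t1) / E - 2 * be ^+ 2 / E ^+ 2 - (E + l1) / r + 2 * y1 ^+ 2 / r ^+ 2))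
    / (E / r) = r * (a * c - b ^+ 2) / E ^+ 4.
Proof.
move=> E0 r0 dE nE rE lE hE tE.
have -> : t1 = - (t0 + d + n) by apply/eqP; rewrite -addr_eq0 -tE; apply/eqP; ring.
have -> : l1 = s * (- 2 * E / r * s) / E ^+ 2 - l0 by rewrite -hE -lE; field.
have -> : y1 ^+ 2 = (E ^+ 2 * r - s ^+ 2) / E - y0 ^+ 2 by rewrite rE; field.
have -> : n = (b ^+ 2 + E * (al ^+ 2 + be ^+ 2)) / E ^+ 2 by rewrite -nE; field.
have -> : d = (a * c - E * (al ^+ 2 + be ^+ 2)) / E ^+ 2 by rewrite -dE; field.
by field; rewrite E0 r0.
Qed.

Section ConformalPatch.
Variables (R : realType) (U : set 'rV[R]_2) (Y : 'rV[R]_2 -> 'rV[R]_3).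
Hypotheses (oU : open U) (sY : smooth_on U Y).
Hypothesis Y_neq0 : forall x, U x -> Y x != 0.
Hypothesis Y_conformal : forall x, U x ->
  exists2 l : R, 0 < l & pullback Y (@dmu2 R) x = l%:M.

(** The partial derivatives of Y enter as named vector fields: identities between
    them are then vector algebra at each point. *)
Variables (D : 'I_2 -> 'rV[R]_2 -> 'rV[R]_3).
Variables (DD : 'I_2 -> 'I_2 -> 'rV[R]_2 -> 'rV[R]_3).
Hypothesis DE : forall i, partial i Y = D i.
Hypothesis DDE : forall i j, partial i (D j) = DD i j.

Let E x := dot (D 0 x) (D 0 x).
Let rho x := dot (Y x) (Y x).
Let W x := cross (D 0 x) (D 1 x).

Let dY x : U x -> differentiable Y x.
Proof. exact: smooth_on_differentiable. Qed.
Let dD i x : U x -> differentiable (D i) x.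
Proof. by rewrite -DE; exact: (smooth_on_differentiable (smooth_on_partial i sY)). Qed.
Let dDD i j x : U x -> differentiable (DD i j) x.
Proof.
rewrite -DDE -DE.
exact: (smooth_on_differentiable (smooth_on_partial i (smooth_on_partial j sY))).
Qed.

Lemma rho_gt0 x : U x -> 0 < rho x.
Proof. by move=> Ux; apply: dot_gt0; exact: Y_neq0. Qed.

Let pullbackE x i j : U x ->
  pullback Y (@dmu2 R) x i j = (rho x)^-1 * dot (D i x) (D j x).
Proof. by move=> /dY dYx; rewrite pullback_dmu2 // !DE. Qed.

Lemma conformal_frame x : U x ->
  [/\ 0 < E x, dot (D 1 x) (D 1 x) = E x & dot (D 0 x) (D 1 x) = 0].
Proof.
move=> Ux; have r0 := rho_gt0 Ux; have [l l0 lE] := Y_conformal Ux.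
have pE i j : dot (D i x) (D j x) = rho x * (l *+ (i == j)).
  have := pullbackE i j Ux; rewrite lE mxE => ->.
  by rewrite mulVKf // gt_eqF.
by rewrite /E !pE /= mulr1n mulr0n mulr0 mulr_gt0.
Qed.

Lemma pullback_conformal x : U x -> pullback Y (@dmu2 R) x = (E x / rho x)%:M.
Proof.
move=> Ux; have [_ E1 E01] := conformal_frame Ux.
have E10 : dot (D 1 x) (D 0 x) = 0 by rewrite dotC.
apply/matrixP => i j; rewrite pullbackE // mxE mulrC.
by case: (ord2P i) => ->; case: (ord2P j) => ->; rewrite ?E1 ?E01 ?E10 ?mul0r.
Qed.

Lemma dot_WW x : U x -> dot (W x) (W x) = E x ^+ 2.
Proof.
move=> Ux; have [_ E1 E01] := conformal_frame Ux.
by rewrite dot_cross_cross dotC in E01 *; rewrite E1 E01 -/(E x); ring.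
Qed.

Let enorm_gt0 x : U x -> 0 < enorm (Y x).
Proof.
move=> Ux; rewrite lt0r sqrtr_ge0 andbT -sqrf_eq0 enorm_dot gt_eqF //.
exact: rho_gt0.
Qed.

Lemma unit_normal_conformal x : U x ->
  unit_normal Y x = (enorm (Y x) / E x) *: W x.
Proof.
move=> Ux; have [E0 _ _] := conformal_frame Ux; have m0 := enorm_gt0 Ux.
rewrite /unit_normal !DE -/(W x) dmu2E inner_scalar dot_WW // -enorm_dot.
rewrite -exprVn -exprMn sqrtr_sqr gtr0_norm ?mulr_gt0 ?invr_gt0 //.
by rewrite invfM invrK.
Qed.

(** The components of the unit normal in the frame E are those of the Euclidean
    unit normal. *)
Lemma frame_normal_conformal x : U x ->
  frame_normal Y x = (E x)^-1 *: W x.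
Proof.
move=> Ux; have [E0 _ _] := conformal_frame Ux; have m0 := enorm_gt0 Ux.
apply/rowP => j; rewrite [LHS]mxE [RHS]mxE dmu2E inner_scalar.
rewrite unit_normal_conformal // dotZl dotZr dot_delta -enorm_dot.
by field; rewrite !gt_eqF.
Qed.

Hypothesis Y_minimal : forall x, U x -> mean_curvature Y x = 0.

(** In the trace of the second fundamental form for dmu^2, the terms of
    [cov_deriv_dmu2] along D 0 and D 1 are tangent, and the term along Y is
    counted once for each of the two directions. *)
Lemma minimal_dot x : U x ->
  dot (DD 0 0 x + DD 1 1 x) (W x) = - 2 * E x / rho x * dot (Y x) (W x).
Proof.
move=> Ux; have [E0 E1 _] := conformal_frame Ux; have r0 := rho_gt0 Ux.
have [Er rr] : E x != 0 /\ rho x != 0 by rewrite !gt_eqF.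
have sE i : second_form Y x i i
    = (enorm (Y x) / (rho x * E x)) * dot (cov_deriv (@dmu2 R) Y i i x) (W x).
  rewrite [LHS]mxE dmu2E inner_scalar unit_normal_conformal // dotZr -/(rho x).
  by field; rewrite rr Er.
have /eqP := Y_minimal Ux.
rewrite /mean_curvature pullback_conformal // invmx_scalar mul_scalar_mx.
rewrite mxtraceZ /mxtrace sum2E !sE -!mulrDr.
rewrite !mulf_eq0 !invr_eq0 !mulf_eq0 !invr_eq0 pnatr_eq0.
rewrite (negPf Er) (negPf rr) (gt_eqF (enorm_gt0 Ux)) /=.
rewrite !cov_deriv_dmu2 ?Y_neq0 // !DE !DDE.
have W0 : dot (D 0 x) (W x) = 0 by rewrite dotC dot_cross_l.
have W1 : dot (D 1 x) (W x) = 0 by rewrite dotC dot_cross_r.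
rewrite !(dotDl, dotNl, dotZl) -/(rho x) W0 W1 E1 -/(E x) => /eqP H.
apply/eqP; rewrite -subr_eq0 -[X in _ == X]H; apply/eqP.
by field.
Qed.

(** The factor E can be differentiated as |Y_u|^2 or as |Y_v|^2.  In the direction
    k, the other vector is the right choice: only the derivatives of Y_uv then
    occur, and not those of Y_uu and Y_vv. *)
Let other (k : 'I_2) : 'I_2 := if k == 0 then 1 else 0.

Let EE x k : U x -> E x = dot (D k x) (D k x).
Proof.
move=> Ux; have [_ E1 _] := conformal_frame Ux.
by case: (ord2P k) => ->; rewrite ?E1.
Qed.

Let partialE i j x : U x -> partial i (E : _ -> R) x = 2 * dot (D j x) (DD i j x).
Proof.
move=> Ux.
rewrite (eq_on_partial (g := fun y => dot (D j y) (D j y) : R) i oU Ux); last first.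
  by move=> y; exact: EE.
rewrite partial_dot ?DDE; [|exact: dD..].
by rewrite (dotC (DD i j x)) mulr_natl.
Qed.

Let partial_rho i x : U x -> partial i (rho : _ -> R) x = 2 * dot (Y x) (D i x).
Proof.
move=> Ux; rewrite partial_dot ?DE; [|exact: dY..].
by rewrite (dotC (D i x)) mulr_natl.
Qed.

(** Half the logarithmic derivative of the conformal factor E / rho. *)
Let psi k x : R :=
  dot (D (other k) x) (DD k (other k) x) / E x - dot (Y x) (D k x) / rho x.

Let dE x : U x -> differentiable E x.
Proof. by move=> Ux; apply: differentiable_dot; exact: dD. Qed.

Let drho x : U x -> differentiable rho x.
Proof. by move=> Ux; apply: differentiable_dot; exact: dY. Qed.

Let E_neq0 x : U x -> E x != 0.
Proof. by move=> /conformal_frame[E0 _ _]; rewrite gt_eqF. Qed.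

Let rho_neq0 x : U x -> rho x != 0.
Proof. by move=> /rho_gt0 r0; rewrite gt_eqF. Qed.

Let partial_factor k x : U x ->
  partial k (fun y => E y / rho y : R) x = 2 * (E x / rho x) * psi k x.
Proof.
move=> Ux; have Er := E_neq0 Ux; have rr := rho_neq0 Ux.
rewrite partial_div //; [|exact: dE|exact: drho].
rewrite (partialE k (other k) Ux) (partial_rho k Ux) /psi.
by field; rewrite Er rr.
Qed.

Let dpsi k x : U x -> differentiable (psi k) x.
Proof.
move=> Ux; apply: differentiableB; apply: differentiableM.
- by apply: differentiable_dot; [exact: dD|exact: dDD].
- by apply: differentiableV; [exact: dE|exact: E_neq0].
- by apply: differentiable_dot; [exact: dY|exact: dD].
- by apply: differentiableV; [exact: drho|exact: rho_neq0].
Qed.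

Let partial_psi k x : U x -> partial k (psi k : _ -> R) x =
  (dot (DD k (other k) x) (DD k (other k) x)
     + dot (D (other k) x) (partial k (DD k (other k)) x)) / E x
  - 2 * dot (D (other k) x) (DD k (other k) x) ^+ 2 / E x ^+ 2
  - (E x + dot (Y x) (DD k k x)) / rho x + 2 * dot (Y x) (D k x) ^+ 2 / rho x ^+ 2.
Proof.
move=> Ux; have Er := E_neq0 Ux; have rr := rho_neq0 Ux.
pose f y := dot (D (other k) y) (DD k (other k) y) : R.
pose g y := dot (Y y) (D k y) : R.
have df : differentiable f x by apply: differentiable_dot; [exact: dD|exact: dDD].
have dg : differentiable g x by apply: differentiable_dot; [exact: dY|exact: dD].
have dEx := dE Ux; have drx := drho Ux.
have -> : partial k (psi k : _ -> R) x
   = partial k (fun y => f y / E y : R) x - partial k (fun y => g y / rho y : R) x.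
  rewrite /partial -deriveB //; apply: diff_derivable; apply: differentiableM => //;
  exact: differentiableV.
rewrite !partial_div // (partialE k (other k) Ux) (partial_rho k Ux).
rewrite /f /g !partial_dot ?DDE ?DE; [|try exact: dY; try exact: dD; exact: dDD..].
rewrite -(EE k Ux).
by field; rewrite Er rr.
Qed.

Let DDC x : U x -> DD 1 0 x = DD 0 1 x.
Proof.
by move=> Ux; rewrite -!DDE -!DE; exact: (smooth_partialC _ _ oU sY).
Qed.

Let F_partial i x : U x -> dot (DD i 0 x) (D 1 x) + dot (D 0 x) (DD i 1 x) = 0.
Proof.
move=> Ux; rewrite -!DDE -partial_dot; [|exact: dD..].
rewrite (eq_on_partial (g := fun=> 0 : R) i oU Ux); first exact: partial_cst.
by move=> y /conformal_frame[].
Qed.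

(** The second derivative of <Y_u, Y_v> = 0 in u and v eliminates the third
    derivatives of Y from Delta E. *)
Let F_partial2 x : U x ->
  dot (partial 0 (DD 0 1) x) (D 1 x) + dot (DD 0 0 x) (DD 1 1 x)
  + dot (DD 0 1 x) (DD 0 1 x) + dot (D 0 x) (partial 1 (DD 1 0) x) = 0.
Proof.
move=> Ux.
have sD i : smooth_on U (D i) by rewrite -DE; exact: smooth_on_partial.
have A : partial 0 (DD 0 1) x = partial 1 (DD 0 0) x.
  rewrite -(eq_on_partial (f := DD 1 0) 0 oU Ux DDC) -!DDE.
  exact: (smooth_partialC _ _ oU (sD 0)).
have B : partial 1 (DD 1 0) x = partial 1 (DD 0 1) x.
  exact: (eq_on_partial 1 oU Ux DDC).
rewrite A B.
have := eq_on_partial (f := fun y => dot (DD 0 0 y) (D 1 y) + dot (D 0 y) (DD 0 1 y) : R)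
  (g := fun=> 0 : R) 1 oU Ux (F_partial 0).
rewrite partial_cst partialD; first last.
- by apply: differentiable_dot; [exact: dD|exact: dDD].
- by apply: differentiable_dot; [exact: dDD|exact: dD].
rewrite !partial_dot ?DDE; [|try exact: dD; exact: dDD..].
rewrite DDC // => <-; ring.
Qed.

(** The third derivatives cancel by [F_partial2]; the rest is an identity between
    the coordinates of Y and its second derivatives in the basis D 0, D 1, W. *)
Lemma gauss_curvature_minimal x : U x ->
  gauss_curvature (pullback Y (@dmu2 R)) x
  = rho x * (dot (DD 0 0 x) (W x) * dot (DD 1 1 x) (W x) - dot (DD 0 1 x) (W x) ^+ 2)
    / E x ^+ 4.
Proof.
move=> Ux; have Er := E_neq0 Ux; have rr := rho_neq0 Ux.
rewrite (gauss_curvature_conformal (phi := fun y => E y / rho y) (psi := psi) oU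
  pullback_conformal _ partial_factor Ux); first last.
- by move=> a; exact: dpsi.
- by move=> y Uy; rewrite mulf_neq0 ?invr_eq0 ?E_neq0 ?rho_neq0.
rewrite !partial_psi // /other /= DDC //.
have F2 := F_partial2 Ux.
have [_ E1 E01] := conformal_frame Ux.
have e0 := partialE 0 0 Ux; rewrite (partialE 0 1 Ux) in e0.
have e1 := partialE 1 0 Ux; rewrite (partialE 1 1 Ux) DDC // in e1.
have f0 := F_partial 0 Ux; have f1 := F_partial 1 Ux; rewrite DDC // in f1.
have H := minimal_dot Ux.
have P a b := parseval a b (erefl (E x)) E1 E01.
have P1 := P (DD 0 0 x) (DD 1 1 x); have P2 := P (DD 0 1 x) (DD 0 1 x).
have P3 := P (Y x) (Y x); have P4 := P (Y x) (DD 0 0 x + DD 1 1 x).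
rewrite -/(W x) in P1 P2 P3 P4.
have two0 : (2 : R) != 0 by rewrite pnatr_eq0.
have {}e0 : dot (DD 0 0 x) (D 0 x) = dot (D 1 x) (DD 0 1 x).
  by rewrite dotC; apply: (mulfI two0).
have {}e1 : dot (DD 1 1 x) (D 1 x) = dot (D 0 x) (DD 0 1 x).
  by rewrite dotC; apply: (mulfI two0).
have {}f0 : dot (DD 0 0 x) (D 1 x) = - dot (D 0 x) (DD 0 1 x).
  by apply/eqP; rewrite -addr_eq0 f0.
have {}f1 : dot (DD 1 1 x) (D 0 x) = - dot (D 1 x) (DD 0 1 x).
  by apply/eqP; rewrite -addr_eq0 dotC addrC (dotC (D 1 x)) f1.
apply: (curvature_algebra (d := dot (DD 0 0 x) (DD 1 1 x)) (s := dot (Y x) (W x))) => //.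
- by rewrite P1 e0 e1 f0 f1; ring.
- by rewrite P2 !(dotC (DD 0 1 x)) (dotC (W x)); ring.
- by rewrite -dotDr P4 !dotDl e0 e1 f0 f1; ring.
- by rewrite -dotDl.
- by rewrite -F2 (dotC (D 1 x)).
Qed.

(** The Euclidean unit normal. *)
Let N x := (E x)^-1 *: W x.

Let dN x : U x -> differentiable N x.
Proof.
move=> Ux; have dW : differentiable W x by apply: differentiable_cross; exact: dD.
apply: differentiable_rV => j.
have -> : (fun y => N y 0 j : R) = (fun y => (E y)^-1 * W y 0 j).
  by apply/funext => y; rewrite mxE.
apply: differentiableM; last exact: differentiable_coord_comp.
by apply: differentiableV; [exact: dE|exact: E_neq0].
Qed.

Let dot_NW v x : dot v (N x) = (E x)^-1 * dot v (W x).
Proof. exact: dotZr. Qed.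

Let dot_NN x : U x -> dot (N x) (N x) = 1.
Proof.
by move=> Ux; rewrite dotZl dotZr dot_WW //; field; exact: E_neq0.
Qed.

Let dot_NdN i x : U x -> dot (N x) (partial i N x) = 0.
Proof.
move=> Ux; have := eq_on_partial (f := fun y => dot (N y) (N y) : R)
  (g := fun=> 1 : R) i oU Ux dot_NN.
rewrite partial_cst partial_dot; [|exact: dN..].
rewrite (dotC (partial i N x)) => /eqP; rewrite -mulr2n mulrn_eq0 => /eqP; exact.
Qed.

(** The Weingarten equations. *)
Let dot_dND i j x : U x -> dot (partial i N x) (D j x) = - dot (DD i j x) (W x) / E x.
Proof.
move=> Ux.
have ND y : U y -> dot (N y) (D j y) = 0.
  by move=> Uy; rewrite dotZl; case: (ord2P j) => ->;
     rewrite ?dot_cross_l ?dot_cross_r mulr0.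
have := eq_on_partial (f := fun y => dot (N y) (D j y) : R)
  (g := fun=> 0 : R) i oU Ux ND.
rewrite partial_cst partial_dot ?DDE; [|exact: dN|exact: dD].
move/eqP; rewrite addr_eq0 => /eqP ->.
by rewrite (dotC (N x)) dot_NW mulNr mulrC.
Qed.

Lemma normal_partial_norm i x : U x ->
  dot (partial i N x) (partial i N x)
  = (dot (DD i 0 x) (W x) ^+ 2 + dot (DD i 1 x) (W x) ^+ 2) / E x ^+ 3.
Proof.
move=> Ux; have [_ E1 E01] := conformal_frame Ux; have E0 := E_neq0 Ux.
have := parseval (partial i N x) (partial i N x) (erefl (E x)) E1 E01.
have -> : dot (partial i N x) (cross (D 0 x) (D 1 x)) = 0.
  have -> : cross (D 0 x) (D 1 x) = E x *: N x by rewrite scalerA mulfV ?scale1r.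
  by rewrite dotZr dotC dot_NdN ?mulr0.
rewrite !dot_dND // => H; apply: (mulfI (expf_neq0 2 E0)); rewrite H.
by field.
Qed.

Lemma normal_partial_triple x : U x ->
  dot (N x) (cross (partial 0 N x) (partial 1 N x))
  = (dot (DD 0 0 x) (W x) * dot (DD 1 1 x) (W x) - dot (DD 0 1 x) (W x) ^+ 2)
    / E x ^+ 3.
Proof.
move=> Ux; have E0 := E_neq0 Ux.
have := dot_dND 1 1 Ux; have := dot_dND 1 0 Ux.
have := dot_dND 0 1 Ux; have := dot_dND 0 0 Ux; rewrite (DDC Ux).
move: (partial 0 N x) (partial 1 N x) => a b a0 a1 b0 b1.
rewrite dotZl dot_cross_cross (dotC (D 0 x) a) (dotC (D 1 x) a).
rewrite (dotC (D 0 x) b) (dotC (D 1 x) b) a0 a1 b0 b1.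
by field.
Qed.

Local Open Scope complex_scope.

Let n k y : R := N y 0 (inord k).
Let dn k i x : R := partial i N x 0 (inord k).

Let differentiable_n k x : U x -> differentiable (n k) x.
Proof. by move=> Ux; apply: differentiable_coord_comp; exact: dN. Qed.

Let partial_n k i x : U x -> partial i (n k : _ -> R) x = dn k i x.
Proof. by move=> Ux; apply: partial_coord; exact: dN. Qed.

Let n_unit x : U x -> n 0 x ^+ 2 + n 1 x ^+ 2 + n 2 x ^+ 2 = 1.
Proof. by move=> Ux; rewrite -(dot_NN Ux) dot3E. Qed.

Let n_tangent i x : U x -> n 0 x * dn 0 i x + n 1 x * dn 1 i x + n 2 x * dn 2 i x = 0.
Proof. by move=> Ux; rewrite -(dot_NdN i Ux) dot3E. Qed.

Let dn_norm i x : U x -> dn 0 i x ^+ 2 + dn 1 i x ^+ 2 + dn 2 i x ^+ 2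
  = (dot (DD i 0 x) (W x) ^+ 2 + dot (DD i 1 x) (W x) ^+ 2) / E x ^+ 3.
Proof. by move=> Ux; rewrite -normal_partial_norm // dot3E. Qed.

Let dn_triple x : U x ->
  n 0 x * (dn 1 0 x * dn 2 1 x - dn 2 0 x * dn 1 1 x)
  + n 1 x * (dn 2 0 x * dn 0 1 x - dn 0 0 x * dn 2 1 x)
  + n 2 x * (dn 0 0 x * dn 1 1 x - dn 1 0 x * dn 0 1 x)
  = (dot (DD 0 0 x) (W x) * dot (DD 1 1 x) (W x) - dot (DD 0 1 x) (W x) ^+ 2)
    / E x ^+ 3.
Proof.
by move=> Ux; rewrite -normal_partial_triple // dot3E cross0 cross1 cross2.
Qed.

(** The two Wirtinger derivatives of f = u + iv satisfy
    4 |f_z|^2 = |grad u|^2 + |grad v|^2 + 2 J and 4 |fbar_z|^2 = |grad u|^2 +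
    |grad v|^2 - 2 J, where J is the Jacobian determinant. *)
Lemma sqr_norm_gauss_derivative (f : 'rV[R]_2 -> R[i]) x : U x ->
  (forall y, U y -> f y = finite_part (stereo (frame_normal Y y))) ->
  1 + n 2 x != 0 ->
  `|wirtinger f x| ^+ 2
    = ((dot (DD 0 0 x) (W x) + dot (DD 1 1 x) (W x)) ^+ 2
       / (4 * E x ^+ 3 * (1 + n 2 x) ^+ 2))%:C /\
  `|wirtinger f x| ^+ 2 - `|wirtinger (fun y => (f y)^*) x| ^+ 2
    = ((dot (DD 0 0 x) (W x) * dot (DD 1 1 x) (W x) - dot (DD 0 1 x) (W x) ^+ 2)
       / (E x ^+ 3 * (1 + n 2 x) ^+ 2))%:C.
Proof.
move=> Ux fE t0; have E0 := E_neq0 Ux.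
pose u y : R := n 0 y / (1 + n 2 y); pose v y : R := n 1 y / (1 + n 2 y).
have fu y : U y -> complex.Re (f y) = u y.
  by move=> Uy; rewrite fE // frame_normal_conformal // stereo_Re.
have fv y : U y -> complex.Im (f y) = v y.
  by move=> Uy; rewrite fE // frame_normal_conformal // stereo_Im.
have fu' y : U y -> complex.Re (f y)^* = u y by move=> Uy; rewrite -fu //; case: (f y).
have fv' y : U y -> complex.Im (f y)^* = - v y.
  by move=> Uy; rewrite -fv //; case: (f y).
have dv : differentiable v x by apply: differentiable_stereo; try exact: differentiable_n.
have dvN i : partial i (fun y => - v y : R) x = - partial i (v : _ -> R) x.
  by rewrite /partial deriveN //; exact: diff_derivable.
have hu := stereo_partial_norm (differentiable_n 0 Ux) (differentiable_n 1 Ux)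
  (differentiable_n 2 Ux) (n_unit Ux) (fun i => partial_n 0 i Ux)
  (fun i => partial_n 1 i Ux) (fun i => partial_n 2 i Ux) (fun i => n_tangent i Ux) t0.
have hj := stereo_jacobian (differentiable_n 0 Ux) (differentiable_n 1 Ux)
  (differentiable_n 2 Ux) (n_unit Ux) (fun i => partial_n 0 i Ux)
  (fun i => partial_n 1 i Ux) (fun i => partial_n 2 i Ux) (fun i => n_tangent i Ux) t0.
have h0 := hu 0; have h1 := hu 1.
rewrite dn_norm // in h0; rewrite dn_norm // DDC // in h1; rewrite dn_triple // in hj.
rewrite -/u -/v in h0 h1 hj.
rewrite (sqr_norm_wirtinger oU Ux fu fv) (sqr_norm_wirtinger oU Ux fu' fv') !dvN.
move: (partial 0 u x) (partial 1 u x) (partial 0 v x) (partial 1 v x) h0 h1 hj.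
move=> u0 u1 v0 v1 h0 h1 hj.
split; last first.
  rewrite -rmorphB; congr (_%:C).
  transitivity (u0 * v1 - u1 * v0); first by field.
  by rewrite hj; field; rewrite E0 t0.
congr (_%:C).
transitivity (((u0 ^+ 2 + v0 ^+ 2) + (u1 ^+ 2 + v1 ^+ 2) + 2 * (u0 * v1 - u1 * v0)) / 4).
  by field.
by rewrite h0 h1 hj; field; rewrite E0 t0.
Qed.

Lemma curvature_gauss_map (f : 'rV[R]_2 -> R[i]) x (gx px : R[i]) : U x ->
  (forall y, U y -> f y = finite_part (stereo (frame_normal Y y))) ->
  stereo (frame_normal Y x) = Some gx ->
  stereo ((enorm (Y x))^-1 *: Y x) = Some px ->
  wirtinger f x != 0 ->
  (gauss_curvature (pullback Y (@dmu2 R)) x)%:C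
  = (`|gx - px| ^+ 2 - `|1 + gx^*%C * px| ^+ 2) ^+ 2
    / ((1 + `|gx| ^+ 2) ^+ 2 * (1 + `|px| ^+ 2) ^+ 2 * `|wirtinger f x| ^+ 2)
    * (`|wirtinger f x| ^+ 2 - `|wirtinger (fun y => (f y)^*) x| ^+ 2).
Proof.
move=> Ux fE gE pE f0; have E0 := E_neq0 Ux; have r0 := rho_neq0 Ux.
have m0 : enorm (Y x) != 0 by rewrite gt_eqF // enorm_gt0.
have mE : rho x = enorm (Y x) ^+ 2 by rewrite enorm_dot.
rewrite frame_normal_conformal // in gE.
have [t0 _] := stereo_Some gE.
have yy : dot ((enorm (Y x))^-1 *: Y x) ((enorm (Y x))^-1 *: Y x) = 1.
  by rewrite dotZl dotZr -/(rho x) mE; field.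
rewrite (stereo_dot (dot_NN Ux) yy gE pE) !dotZl dotZr (dotC (W x)).
have := sqr_norm_gauss_derivative Ux fE t0.
have : `|wirtinger f x| ^+ 2 != 0 by rewrite expf_neq0 // normr_eq0.
move: (`|wirtinger f x| ^+ 2) (`|wirtinger (fun y => (f y)^*) x| ^+ 2) => G G'.
move=> G0 [GE ->].
(* By minimality, g_z <> 0 means that the angle function does not vanish. *)
have H0 : dot (DD 0 0 x) (W x) + dot (DD 1 1 x) (W x) != 0.
  by apply: contra G0 => /eqP H; rewrite GE H expr0n /= mul0r.
have hs := minimal_dot Ux; rewrite dotDl in hs.
have s0 : dot (Y x) (W x) != 0.
  by apply: contra H0 => /eqP s0; rewrite hs s0 mulr0.
have [A0 B0] : 1 + `|gx| ^+ 2 != 0 /\ 1 + `|px| ^+ 2 != 0.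
  by split; rewrite gt_eqF // ltr_wpDr // exprn_ge0.
move: (1 + _ ^+ 2) (1 + `|px| ^+ 2) A0 B0 => A B A0 B0.
rewrite gauss_curvature_minimal //.
set h := _ - _ ^+ 2; set d := _^-1 * _.
have -> : (- d%:C * (A * B)) ^+ 2 / (A ^+ 2 * B ^+ 2 * G) = (d%:C) ^+ 2 / G.
  by field; rewrite A0 B0 G0.
rewrite GE -rmorphXn -fmorphV -!rmorphM; congr (_%:C).
by rewrite hs /d /h mE; field; rewrite t0 E0 m0 s0.
Qed.

(** Up to positive factors, the Jacobian determinant of g in either chart of the
    extended plane is the area distortion of the normal, which is the Euclidean
    Gauss curvature. *)
Lemma det_jacobian_gauss_map (f : 'rV[R]_2 -> option R[i]) x : U x ->
  (forall y, U y -> f y = stereo (frame_normal Y y)) ->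
  let h y := to_plane (sphere_coord (f x) (f y)) in
  differentiable h x /\
  exists2 c, c != 0 &
    \det ('J h x) = c *
    (dot (DD 0 0 x) (W x) * dot (DD 1 1 x) (W x) - dot (DD 0 1 x) (W x) ^+ 2).
Proof.
move=> Ux fE /=; have E0 := E_neq0 Ux.
have [d0 d1 d2] : [/\ differentiable (n 0) x, differentiable (n 1) x & differentiable (n 2) x].
  by split; exact: differentiable_n.
have fN y : U y -> f y = stereo (N y).
  by move=> Uy; rewrite fE // frame_normal_conformal.
have nU : \near x, U x by exact: open_nbhs_nbhs.
case fx : (f x) => [w|].
  have t0 : 1 + n 2 x != 0 := (stereo_Some (etrans (esym (fN x Ux)) fx)).1.
  pose u y : R := n 0 y / (1 + n 2 y); pose v y : R := n 1 y / (1 + n 2 y).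
  have du : differentiable u x by exact: differentiable_stereo.
  have dv : differentiable v x by exact: differentiable_stereo.
  have near_uv : \near x, to_plane (Complex (u x) (v x)) = to_plane (sphere_coord (Some w) (f x)).
    near=> y; have Uy : U y by near: y.
    by rewrite /= fN // /u /v -stereo_Re -stereo_Im; case: (finite_part _).
  have [dh ->] := near_eq_jacobian near_uv (differentiable_to_plane du dv).
  split=> //; exists (E x ^+ 3 * (1 + n 2 x) ^+ 2)^-1.
    by rewrite invr_eq0 mulf_neq0 // expf_neq0.
  rewrite (det_jacobian_to_plane du dv).
  have := stereo_jacobian d0 d1 d2 (n_unit Ux) (fun i => partial_n 0 i Ux)
    (fun i => partial_n 1 i Ux) (fun i => partial_n 2 i Ux) (fun i => n_tangent i Ux) t0.
  by move=> ->; rewrite dn_triple //; field; rewrite E0 t0.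
(* At infinity the normal points to the south pole, and the coordinate of the
   extended plane is the projection of the normal with its last two components
   reversed. *)
have n2x : n 2 x = -1.
  move: fx; rewrite fN // /stereo; case: eqP => // H _.
  by apply/eqP; rewrite -addr_eq0 addrC; apply/eqP.
have t0 : 1 + - n 2 x != 0 by rewrite n2x opprK -mulr2n pnatr_eq0.
pose m1 y : R := - n 1 y; pose m2 y : R := - n 2 y.
have [e1 e2] : differentiable m1 x /\ differentiable m2 x.
  by split; exact: differentiableN.
pose u y : R := n 0 y / (1 + m2 y); pose v y : R := m1 y / (1 + m2 y).
have du : differentiable u x by exact: differentiable_stereo.
have dv : differentiable v x by exact: differentiable_stereo.
have near_neg : \near x, n 2 x < 0.
  have nlt : nbhs (n 2 x) [set z : R | z < 0].
    by apply: open_nbhs_nbhs; split; [exact: open_lt | rewrite /= n2x ltrN10].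
  exact: (differentiable_continuous d2 nlt).
have near_uv : \near x, to_plane (Complex (u x) (v x)) = to_plane (sphere_coord None (f x)).
  near=> y; have Uy : U y by near: y.
  have n2y : n 2 y < 0 by near: y.
  rewrite fN // (stereo_south (n_unit Uy)) //.
  by rewrite lt_eqF //; exact: lt_trans n2y ltr01.
have [dh ->] := near_eq_jacobian near_uv (differentiable_to_plane du dv).
split=> //; exists (E x ^+ 3 * (1 + m2 x) ^+ 2)^-1.
  by rewrite invr_eq0 mulf_neq0 // expf_neq0.
rewrite (det_jacobian_to_plane du dv).
have mm : n 0 x ^+ 2 + m1 x ^+ 2 + m2 x ^+ 2 = 1 by rewrite -(n_unit Ux) /m1 /m2; ring.
have p1 i : partial i (m1 : _ -> R) x = - dn 1 i x.
  by rewrite -partial_n // /partial deriveN //; exact: diff_derivable.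
have p2 i : partial i (m2 : _ -> R) x = - dn 2 i x.
  by rewrite -partial_n // /partial deriveN //; exact: diff_derivable.
have := stereo_jacobian d0 e1 e2 mm (fun i => partial_n 0 i Ux) p1 p2 _ t0.
move=> ->; last by move=> i; rewrite -[RHS](n_tangent i Ux) /m1 /m2; ring.
rewrite /m1 triple_flip dn_triple //.
by field; rewrite E0 t0.
Unshelve. all: by end_near. Qed.

Lemma singular_gauss_map_curvature0 (f : 'rV[R]_2 -> option R[i]) x : U x ->
  (forall y, U y -> f y = stereo (frame_normal Y y)) ->
  let h y := to_plane (sphere_coord (f x) (f y)) in
  differentiable h x /\
  (\det ('J h x) = 0 -> gauss_curvature (pullback Y (@dmu2 R)) x = 0).
Proof.
move=> Ux fE /=; have [dh [c c0 detE]] := det_jacobian_gauss_map Ux fE.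
split=> [|/eqP]; first exact: dh.
rewrite detE mulf_eq0 (negPf c0) /= => /eqP second_det0.
by rewrite gauss_curvature_minimal // second_det0 mulr0 mul0r.
Qed.

End ConformalPatch.

(** * Minimal conformal immersions of surfaces *)

Section Surface.
Variables (R : realType) (S : oriented_riemannian_surface R).
Variables (X : S -> 'rV[R]_3) (g : S -> option R[i]) (K : S -> R).
Hypotheses (X_neq0 : forall q, X q != 0) (X_immersion : immersion X).
Hypotheses (X_conformal : conformal_map X) (X_minimal : minimal X).
Hypotheses (g_gauss : is_gauss_map X g) (K_curvature : is_curvature X K).

Lemma cimg_open (c : chart R S) : atlas c -> open (cimg c).
Proof. by case/atlas_chart => -[]. Qed.

Lemma cinvK (c : chart R S) q : atlas c -> cdom c q -> cinv c (cmap c q) = q.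
Proof. by case/atlas_chart => _ cK _ _; exact: cK. Qed.

Lemma gauss_map_chart (c : chart R S) y : atlas c -> cimg c y ->
  g (cinv c y) = stereo (frame_normal (X \o cinv c) y).
Proof. by move=> ac [q cq <-]; rewrite cinvK //; exact: g_gauss. Qed.

Lemma pullback_conformal_chart (c : chart R S) y :
  conformal_coordinate c -> cimg c y ->
  exists2 l : R, 0 < l & pullback (X \o cinv c) (@dmu2 R) y = l%:M.
Proof.
move=> [ac conf_c] cy; have [l l0 ->] := X_conformal ac cy.
have [m m0 ->] := conf_c y cy.
by exists (l * m); [exact: mulr_gt0|rewrite scale_scalar_mx].
Qed.

Lemma curvature_formula (c : chart R S) (q : S) (gq pq : R[i]) :
  conformal_coordinate c -> cdom c q ->
  g q = Some gq -> sphere_projection X q = Some pq ->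
  g_z c g q != 0 ->
  (real_complex R (K q)) =
    (`|gq - pq| ^+ 2 - `|1 + gq^*%C * pq| ^+ 2) ^+ 2
    / ((1 + `|gq| ^+ 2) ^+ 2 * (1 + `|pq| ^+ 2) ^+ 2 * `|g_z c g q| ^+ 2)
    * (`|g_z c g q| ^+ 2 - `|gbar_z c g q| ^+ 2).
Proof.
move=> cc cq gE pE gz0; have ac := cc.1.
have Ux : cimg c (cmap c q) by exists q.
rewrite (K_curvature ac cq) /gbar_z.
set Y := X \o cinv c; set U := cimg c in Ux.
have oU : open U by exact: cimg_open.
have sY : smooth_on U Y by exact: X_immersion.1.
have Y0 y : U y -> Y y != 0 by move=> _; exact: X_neq0.
have Yc y : U y -> exists2 l : R, 0 < l & pullback Y (@dmu2 R) y = l%:M.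
  exact: pullback_conformal_chart.
have Ym : forall y, U y -> mean_curvature Y y = 0 by exact: X_minimal.
apply: (curvature_gauss_map oU sY Y0 Yc (fun=> erefl) (fun _ _ => erefl) Ym Ux) => //.
- by move=> y Uy; rewrite gauss_map_chart.
- by rewrite -gauss_map_chart // cinvK.
- by rewrite /Y /= cinvK.
Qed.

Lemma chart_overlap_near (c d : chart R S) q : atlas c -> cdom c q -> cdom d q ->
  atlas d -> \forall y \near cmap c q, cimg c y /\ cdom d (cinv c y).
Proof.
move=> ac cq dq ad; have oc := cimg_open ac.
have Ux : cimg c (cmap c q) by exists q.
have [_ _ _ cont] := atlas_chart ac.
rewrite continuous_open_subspace // in cont.
have nd : nbhs (cinv c (cmap c q)) (cdom d).
  rewrite cinvK //; apply: open_nbhs_nbhs; split=> //.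
  by have [[]] := atlas_chart ad.
have Ux' : cmap c q \in cimg c by rewrite inE.
have := cont _ Ux' _ nd => nc.
by apply: filterI => //; apply: open_nbhs_nbhs.
Qed.

(** The curvature is computed in a conformal chart d, while the differential of g
    may be singular in another chart c; the transition map is a local
    diffeomorphism, so g is singular in d as well. *)
Lemma curvature_singular (q : S) : singular_point g q -> K q = 0.
Proof.
case=> c [ac cq singular].
have [d [ad dq conf_d]] := isothermal q.
have cd : conformal_coordinate d by [].
have Vy : cimg d (cmap d q) by exists q.
set Y := X \o cinv d; set V := cimg d in Vy.
have oV : open V by exact: cimg_open.
have sY : smooth_on V Y by exact: X_immersion.1.
have Y0 y : V y -> Y y != 0 by move=> _; exact: X_neq0.
have Yc y : V y -> exists2 l : R, 0 < l & pullback Y (@dmu2 R) y = l%:M.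
  exact: pullback_conformal_chart.
have Ym : forall y, V y -> mean_curvature Y y = 0 by exact: X_minimal.
have [dh detK] := singular_gauss_map_curvature0 oV sY Y0 Yc (fun=> erefl)
  (fun _ _ => erefl) Ym Vy (fun y Uy => gauss_map_chart ad Uy).
rewrite (K_curvature ad dq); apply: detK.
rewrite cinvK // in dh *.
have [tr_smooth tr_det] := atlas_compat ac ad.
have ov : overlap c d (cmap c q) by exists q.
have dtr := smooth_on_differentiable tr_smooth ov.
have tq : transition c d (cmap c q) = cmap d q by rewrite /transition /= cinvK.
rewrite -tq in dh *.
have near_tr := chart_overlap_near ac cq dq ad.
have [|_ JE] := @near_eq_jacobian _ _ _ _
  (fun x => to_plane (sphere_coord (g q) (g (cinv c x)))) (cmap c q) _
  (differentiable_comp dtr dh).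
  apply: filterS near_tr => y [_ dy] /=.
  by rewrite /transition /= cinvK.
have tr_unit : 'J (transition c d) (cmap c q) \in unitmx.
  by rewrite unitmxE unitfE; exact: (lt0r_neq0 (tr_det _ ov)).
apply/eqP; apply: contraR singular => det_neq0.
rewrite JE (jacobian_comp dtr dh) unitmx_mul.
apply/andP; split; first exact: tr_unit.
by rewrite unitmxE unitfE.
Qed.

End Surface.

Local Open Scope complex_scope.

Theorem lemma4p11 (R : realType) (S : oriented_riemannian_surface R)
    (X : S -> 'rV[R]_3) (g : S -> option R[i]) (K : S -> R)
    (X_neq0 : forall q, X q != 0)
    (X_immersion : immersion X)
    (X_conformal : conformal_map X)
    (X_minimal : minimal X)
    (g_gauss : is_gauss_map X g)
    (K_curvature : is_curvature X K) :
  (forall (c : chart R S) (q : S) (gq pq : R[i]),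
     conformal_coordinate c -> cdom c q ->
     g q = Some gq -> sphere_projection X q = Some pq ->
     g_z c g q != 0 ->
     (K q)%:C =
       (`|gq - pq| ^+ 2 - `|1 + gq^*%C * pq| ^+ 2) ^+ 2
       / ((1 + `|gq| ^+ 2) ^+ 2 * (1 + `|pq| ^+ 2) ^+ 2 * `|g_z c g q| ^+ 2)
       * (`|g_z c g q| ^+ 2 - `|gbar_z c g q| ^+ 2))
  /\ (forall q : S, singular_point g q -> K q = 0).
Proof.
split; first exact: curvature_formula.
exact: curvature_singular.
Qed.
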